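(* Let $\Gamma$ be a typing environment and $\sigma\triangleright P$ a configuration with $\Gamma\vdash\sigma\triangleright P$. If $\sigma\triangleright P\to\sigma'\triangleright P'$, then there exists a typing environment $\Gamma'$ such that $\Gamma'\vdash\sigma'\triangleright P'$.
   Context: Syntax (π-calculus with allocation). Channel names $c,d\in\mathcal N$, variables $x,y$, identifiers $u,v$ ranging over both, process variables $X$. Processes: $P,Q ::= u!\langle\vec v\rangle.P \mid u?(\vec x).P \mid \mathbf 0 \mid \mathsf{if}\ u=v\ \mathsf{then}\ P\ \mathsf{else}\ Q \mid \mathsf{rec}\,X.P \mid X \mid P\mid Q \mid (\nu c{:}s)P \mid \mathsf{alloc}\,x.P \mid \mathsf{free}\,u.P$, where $s\in\{\top,\bot\}$ (allocated/deallocated). Input binds $\vec x$, $\mathsf{alloc}$ binds $x$, $(\nu c{:}s)$ binds $c$, $\mathsf{rec}$ binds $X$. A channel state is a finite partial map $\sigma$ from channel names to $\{\top,\bot\}$; a configuration $\sigma\triangleright P$ requires the free names of $P$ to lie in $\mathrm{dom}(\sigma)$; it is closed if $P$ has no free variables. Contexts: $\mathcal C ::= [-]\mid \mathcal C\mid P\mid P\mid\mathcal C\mid (\nu c)\mathcal C$, applied to configurations by $[\sigma\triangleright P]=\sigma\triangleright P$; if $\mathcal C[\sigma\triangleright P]=\sigma'\triangleright P'$ then $(\mathcal C\mid Q)[\sigma\triangleright P]=\sigma'\triangleright(P'\mid Q)$, $(Q\mid\mathcal C)[\sigma\triangleright P]=\sigma'\triangleright(Q\mid P')$; and if $\mathcal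 C[\sigma\triangleright P]=\sigma',c{:}s\triangleright P'$ then $((\nu c)\mathcal C)[\sigma\triangleright P]=\sigma'\triangleright(\nu c{:}s)P'$. $\equiv$ is a standard π-calculus structural equivalence. Reduction $\to$ is the least relation on closed configurations closed under contexts (if $\sigma\triangleright P\to\sigma''\triangleright P''$ then $\mathcal C[\sigma\triangleright P]\to\mathcal C[\sigma''\triangleright P'']$) satisfying: $\sigma\triangleright c!\langle\vec b\rangle.Q\mid c?(\vec x).P\to\sigma\triangleright Q\mid P\{\vec b/\vec x\}$ if $\sigma(c)=\top$; $\sigma\triangleright\mathsf{rec}\,X.P\to\sigma\triangleright P\{\mathsf{rec}\,X.P/X\}$; $\sigma\triangleright\mathsf{if}\ c=c\ \mathsf{then}\ P\ \mathsf{else}\ Q\to\sigma\triangleright P$; $\sigma\triangleright\mathsf{if}\ c=d\ \mathsf{then}\ P\ \mathsf{else}\ Q\to\sigma\triangleright Q$ if $c\ne d$; $\sigma\triangleright\mathsf{alloc}\,x.P\to\sigma\triangleright(\nu c{:}\top)(P\{c/x\})$ if $c\notin\mathrm{dom}(\sigma)$; $\sigma,c{:}\top\triangleright\mathsf{free}\,c.P\to\sigma,c{:}\bot\triangleright P$; and if $P\equiv P_1$, $\sigma\triangleright P_1\to\sigma'\triangleright Q_1$ and $Q_1\equiv Q$ then $\sigma\triangleright P\to\sigma'\triangleright Q$. Types: $T::=[T_1,\dots,T_n]^a\mid\mathsf{Proc}$, attributes $a::=\mathsf{aff}\mid\mathsf{un}\mid\bullet_i$ ($i\in\mathbb N$;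 $\bullet_i$ = unique after $i$ steps). Typing environments are finite multisets of assumptions $u:T$ or $X:\mathsf{Proc}$. Decrement: $\Gamma,u:[\vec T]^{a-1}$ is $\Gamma$ if $a=\mathsf{aff}$, $\Gamma,u:[\vec T]^{\mathsf{un}}$ if $a=\mathsf{un}$, $\Gamma,u:[\vec T]^{\bullet_i}$ if $a=\bullet_{i+1}$. Splitting: $[\vec T]^{\mathsf{un}}=[\vec T]^{\mathsf{un}}\circ[\vec T]^{\mathsf{un}}$, $\mathsf{Proc}=\mathsf{Proc}\circ\mathsf{Proc}$, $[\vec T]^{\bullet_i}=[\vec T]^{\mathsf{aff}}\circ[\vec T]^{\bullet_{i+1}}$. Subtyping rules: $\bullet_i\le\bullet_{i+1}$, $\bullet_{i+1}\le\mathsf{un}$, $\mathsf{un}\le\mathsf{aff}$, $[\vec T]^{a_1}\le[\vec T]^{a_2}$ if $a_1\le a_2$. The judgement $\Gamma\vdash P$ is inductively defined by (bound variables fresh, commas denote multiset union): if $\Gamma,u:[\vec T]^{a-1},\vec x:\vec T\vdash P$ then $\Gamma,u:[\vec T]^a\vdash u?(\vec x).P$; if $\Gamma,u:[\vec T]^{a-1}\vdash P$ then $\Gamma,u:[\vec T]^a,\vec v:\vec T\vdash u!\langle\vec v\rangle.P$; if $\Gamma_1\vdash P$ and $\Gamma_2\vdash Q$ then $\Gamma_1,\Gamma_2\vdash P\mid Q$; if $u,v$ occur in $\Gamma$, $\Gamma\vdash P$ and $\Gamma\vdash Q$ then $\Gamma\vdash\mathsf{if}\ u=v\ \mathsf{then}\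 P\ \mathsf{else}\ Q$; if $\Gamma^{\mathsf{un}},X:\mathsf{Proc}\vdash P$ then $\Gamma^{\mathsf{un}}\vdash\mathsf{rec}\,X.P$, where $\Gamma^{\mathsf{un}}$ contains only unrestricted assumptions; $X:\mathsf{Proc}\vdash X$; if $\Gamma,x:[\vec T]^{\bullet_0}\vdash P$ then $\Gamma\vdash\mathsf{alloc}\,x.P$; if $\Gamma\vdash P$ then $\Gamma,u:[\vec T]^{\bullet_0}\vdash\mathsf{free}\,u.P$; $\emptyset\vdash\mathbf 0$; if $\Gamma,c:T\vdash P$ then $\Gamma\vdash(\nu c{:}\top)P$; if $\Gamma\vdash P$ then $\Gamma\vdash(\nu c{:}\bot)P$; and the structural rules: if $T=T_1\circ T_2$ and $\Gamma,u:T_1,u:T_2\vdash P$ then $\Gamma,u:T\vdash P$; if $\Gamma\vdash P$ then $\Gamma,u:T\vdash P$; if $\Gamma,u:T_2\vdash P$ and $T_1\le T_2$ then $\Gamma,u:T_1\vdash P$; if $\Gamma,u:[\vec T_2]^{\bullet_0}\vdash P$ then $\Gamma,u:[\vec T_1]^{\bullet_0}\vdash P$. Configuration typing: $\Gamma\vdash\sigma\triangleright P$ holds iff $\sigma(c)=\top$ for every channel name $c\in\mathrm{dom}(\Gamma)$, $\Gamma\vdash P$, and $\Gamma$ is a partial function. *)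

(* Defs.v *)
(* π-calculus with allocation: syntax, structural equivalence, reduction and
   typing.  Representation: locally nameless.  Bound identifiers (variables
   bound by input / alloc, and channel names bound by ν) are de Bruijn indices
   [BV i]; free variables are [FV x]; free channel names are [Nm c].
   Process variables bound by rec are de Bruijn indices [PBV i], free ones
   [PFV X].  Channel states σ are finite maps ({fmap nat -> st}). *)
From Stdlib Require Import List Permutation.
From mathcomp Require Import all_boot finmap.

Set Implicit Arguments.
Unset Strict Implicit.
Unset Printing Implicit Defensive.

Local Open Scope fset_scope.
Local Open Scope fmap_scope.

Inductive ident : Type :=
| BV (i : nat)
| FV (x : nat)
| Nm (c : nat).

Inductive pvar : Type :=
| PBV (i : nat)
| PFV (X : nat).

(* channel states: Top = allocated (⊤), Bot = deallocated (⊥) *)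
Inductive st : Type := Top | Bot.

Inductive proc : Type :=
| POut (u : ident) (vs : list ident) (P : proc)
| PInp (u : ident) (n : nat) (P : proc)           (* u?(x_0..x_{n-1}).P, binds n *)
| PNil
| PIf (u v : ident) (P Q : proc)
| PRec (P : proc)                                 (* rec X.P, binds a process var *)
| PVar (X : pvar)
| PPar (P Q : proc)
| PNu (s : st) (P : proc)                         (* (ν c:s) P, binds a name *)
| PAlloc (P : proc)                               (* alloc x.P, binds a variable *)
| PFree (u : ident) (P : proc).

(** Opening: replace bound indices k, k+1, ... by the identifiers [us]
    (inside the bodies of input binders, index j of the binder of arity n is
    the (j)-th bound variable x_j). *)
Definition id_open (k : nat) (us : list ident) (u : ident) : ident :=
  match u with
  | BV i => if Nat.leb k i then List.nth (i - k) us (BV i) else BV i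
  | _ => u
  end.

Fixpoint popen (k : nat) (us : list ident) (P : proc) : proc :=
  match P with
  | POut u vs P => POut (id_open k us u) (List.map (id_open k us) vs) (popen k us P)
  | PInp u n P => PInp (id_open k us u) n (popen (k + n) us P)
  | PNil => PNil
  | PIf u v P Q => PIf (id_open k us u) (id_open k us v) (popen k us P) (popen k us Q)
  | PRec P => PRec (popen k us P)
  | PVar X => PVar X
  | PPar P Q => PPar (popen k us P) (popen k us Q)
  | PNu s P => PNu s (popen (S k) us P)
  | PAlloc P => PAlloc (popen (S k) us P)
  | PFree u P => PFree (id_open k us u) (popen k us P)
  end.

Definition open (us : list ident) (P : proc) : proc := popen 0 us P.

Definition id_close (k c : nat) (u : ident) : ident :=
  match u with
  | Nm d => if Nat.eqb d c then BV k else u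
  | _ => u
  end.

Fixpoint pclose (k c : nat) (P : proc) : proc :=
  match P with
  | POut u vs P => POut (id_close k c u) (List.map (id_close k c) vs) (pclose k c P)
  | PInp u n P => PInp (id_close k c u) n (pclose (k + n) c P)
  | PNil => PNil
  | PIf u v P Q => PIf (id_close k c u) (id_close k c v) (pclose k c P) (pclose k c Q)
  | PRec P => PRec (pclose k c P)
  | PVar X => PVar X
  | PPar P Q => PPar (pclose k c P) (pclose k c Q)
  | PNu s P => PNu s (pclose (S k) c P)
  | PAlloc P => PAlloc (pclose (S k) c P)
  | PFree u P => PFree (id_close k c u) (pclose k c P)
  end.

Definition close (c : nat) (P : proc) : proc := pclose 0 c P.

Fixpoint pvopen (k : nat) (R : proc) (P : proc) : proc :=
  match P with
  | POut u vs P => POut u vs (pvopen k R P)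
  | PInp u n P => PInp u n (pvopen k R P)
  | PNil => PNil
  | PIf u v P Q => PIf u v (pvopen k R P) (pvopen k R Q)
  | PRec P => PRec (pvopen (S k) R P)
  | PVar (PBV i) => if Nat.eqb i k then R else PVar (PBV i)
  | PVar X => PVar X
  | PPar P Q => PPar (pvopen k R P) (pvopen k R Q)
  | PNu s P => PNu s (pvopen k R P)
  | PAlloc P => PAlloc (pvopen k R P)
  | PFree u P => PFree u (pvopen k R P)
  end.

Definition pvsubst (R P : proc) : proc := pvopen 0 R P.

Definition id_bvmap (f : nat -> nat) (k : nat) (u : ident) : ident :=
  match u with
  | BV i => if Nat.ltb i k then BV i else BV (k + f (i - k))
  | _ => u
  end.

Fixpoint bvmap (f : nat -> nat) (k : nat) (P : proc) : proc :=
  match P with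
  | POut u vs P => POut (id_bvmap f k u) (List.map (id_bvmap f k) vs) (bvmap f k P)
  | PInp u n P => PInp (id_bvmap f k u) n (bvmap f (k + n) P)
  | PNil => PNil
  | PIf u v P Q => PIf (id_bvmap f k u) (id_bvmap f k v) (bvmap f k P) (bvmap f k Q)
  | PRec P => PRec (bvmap f k P)
  | PVar X => PVar X
  | PPar P Q => PPar (bvmap f k P) (bvmap f k Q)
  | PNu s P => PNu s (bvmap f (S k) P)
  | PAlloc P => PAlloc (bvmap f (S k) P)
  | PFree u P => PFree (id_bvmap f k u) (bvmap f k P)
  end.

Definition shift (P : proc) : proc := bvmap S 0 P.
Definition swap01 (P : proc) : proc :=
  bvmap (fun i => match i with 0 => 1 | 1 => 0 | j => j end) 0 P.

Definition id_lc (k : nat) (u : ident) : Prop :=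
  match u with BV i => i < k | _ => True end.

Fixpoint lc_at (k kp : nat) (P : proc) : Prop :=
  match P with
  | POut u vs P => id_lc k u /\ List.Forall (id_lc k) vs /\ lc_at k kp P
  | PInp u n P => id_lc k u /\ lc_at (k + n) kp P
  | PNil => True
  | PIf u v P Q => id_lc k u /\ id_lc k v /\ lc_at k kp P /\ lc_at k kp Q
  | PRec P => lc_at k (S kp) P
  | PVar (PBV i) => i < kp
  | PVar (PFV _) => True
  | PPar P Q => lc_at k kp P /\ lc_at k kp Q
  | PNu _ P => lc_at (S k) kp P
  | PAlloc P => lc_at (S k) kp P
  | PFree u P => id_lc k u /\ lc_at k kp P
  end.

Definition lc (P : proc) : Prop := lc_at 0 0 P.

Definition id_names (u : ident) : list nat := match u with Nm c => [:: c] | _ => [::] end.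
Definition id_vars (u : ident) : list nat := match u with FV x => [:: x] | _ => [::] end.

Fixpoint fnames (P : proc) : list nat :=
  match P with
  | POut u vs P => id_names u ++ List.flat_map id_names vs ++ fnames P
  | PInp u _ P => id_names u ++ fnames P
  | PNil => [::]
  | PIf u v P Q => id_names u ++ id_names v ++ fnames P ++ fnames Q
  | PRec P => fnames P
  | PVar _ => [::]
  | PPar P Q => fnames P ++ fnames Q
  | PNu _ P => fnames P
  | PAlloc P => fnames P
  | PFree u P => id_names u ++ fnames P
  end.

Fixpoint fvars (P : proc) : list nat :=
  match P with
  | POut u vs P => id_vars u ++ List.flat_map id_vars vs ++ fvars P
  | PInp u _ P => id_vars u ++ fvars P
  | PNil => [::]
  | PIf u v P Q => id_vars u ++ id_vars v ++ fvars P ++ fvars Q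
  | PRec P => fvars P
  | PVar _ => [::]
  | PPar P Q => fvars P ++ fvars Q
  | PNu _ P => fvars P
  | PAlloc P => fvars P
  | PFree u P => id_vars u ++ fvars P
  end.

Fixpoint fpvars (P : proc) : list nat :=
  match P with
  | POut _ _ P | PInp _ _ P | PRec P | PNu _ P | PAlloc P | PFree _ P => fpvars P
  | PNil => [::]
  | PIf _ _ P Q | PPar P Q => fpvars P ++ fpvars Q
  | PVar (PFV X) => [:: X]
  | PVar (PBV _) => [::]
  end.

Definition state := {fmap nat -> st}.

(* σ ▷ P is a configuration: free names of P lie in dom σ (and P is a
   genuine, locally closed, process); it is closed if P has no free variables *)
Definition config (σ : state) (P : proc) : Prop :=
  lc P /\ (forall c, List.In c (fnames P) -> c \in domf σ).

Definition closed_config (σ : state) (P : proc) : Prop :=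
  config σ P /\ fvars P = [::].

Inductive sc : proc -> proc -> Prop :=
| sc_par_nil P : sc (PPar P PNil) P
| sc_par_comm P Q : sc (PPar P Q) (PPar Q P)
| sc_par_assoc P Q R : sc (PPar (PPar P Q) R) (PPar P (PPar Q R))
| sc_nu_nil s : sc (PNu s PNil) PNil
| sc_nu_swap s s' P : sc (PNu s (PNu s' P)) (PNu s' (PNu s (swap01 P)))
| sc_extr s P Q : sc (PPar (PNu s P) Q) (PNu s (PPar P (shift Q)))
  (* (νc:s)P | Q ≡ (νc:s)(P | Q) when c ∉ fn(Q) *)
| sc_refl P : sc P P
| sc_sym P Q : sc P Q -> sc Q P
| sc_trans P Q R : sc P Q -> sc Q R -> sc P R
| sc_out u vs P P' : sc P P' -> sc (POut u vs P) (POut u vs P')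
| sc_inp u n P P' : sc P P' -> sc (PInp u n P) (PInp u n P')
| sc_if u v P P' Q Q' : sc P P' -> sc Q Q' -> sc (PIf u v P Q) (PIf u v P' Q')
| sc_rec P P' : sc P P' -> sc (PRec P) (PRec P')
| sc_par P P' Q Q' : sc P P' -> sc Q Q' -> sc (PPar P Q) (PPar P' Q')
| sc_nu s P P' : sc P P' -> sc (PNu s P) (PNu s P')
| sc_alloc P P' : sc P P' -> sc (PAlloc P) (PAlloc P')
| sc_free u P P' : sc P P' -> sc (PFree u P) (PFree u P').

Inductive ctx : Type :=
| CHole
| CParL (C : ctx) (Q : proc)
| CParR (Q : proc) (C : ctx)
| CNu (c : nat) (C : ctx).

Fixpoint plug (C : ctx) (σ : state) (P : proc) : option (state * proc) :=
  match C with
  | CHole => Some (σ, P)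
  | CParL C Q =>
      match plug C σ P with Some (σ', P') => Some (σ', PPar P' Q) | None => None end
  | CParR Q C =>
      match plug C σ P with Some (σ', P') => Some (σ', PPar Q P') | None => None end
  | CNu c C =>
      match plug C σ P with
      | Some (σ', P') =>
          match σ'.[? c] with
          | Some s => Some (σ'.[~ c], PNu s (close c P'))
          | None => None
          end
      | None => None
      end
  end.

Inductive red : state -> proc -> state -> proc -> Prop :=
| red_com σ c bs n P Q :
    closed_config σ (PPar (POut (Nm c) (List.map Nm bs) Q) (PInp (Nm c) n P)) ->
    closed_config σ (PPar Q (open (List.map Nm bs) P)) ->
    List.length bs = n ->
    σ.[? c] = Some Top ->
    red σ (PPar (POut (Nm c) (List.map Nm bs) Q) (PInp (Nm c) n P))
        σ (PPar Q (open (List.map Nm bs) P))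
| red_rec σ P :
    closed_config σ (PRec P) -> closed_config σ (pvsubst (PRec P) P) ->
    red σ (PRec P) σ (pvsubst (PRec P) P)
| red_if_t σ c P Q :
    closed_config σ (PIf (Nm c) (Nm c) P Q) -> closed_config σ P ->
    red σ (PIf (Nm c) (Nm c) P Q) σ P
| red_if_f σ c d P Q :
    closed_config σ (PIf (Nm c) (Nm d) P Q) -> closed_config σ Q ->
    c <> d ->
    red σ (PIf (Nm c) (Nm d) P Q) σ Q
| red_alloc σ c P :
    closed_config σ (PAlloc P) ->
    closed_config σ (PNu Top (close c (open [:: Nm c] P))) ->
    c \notin domf σ ->
    red σ (PAlloc P) σ (PNu Top (close c (open [:: Nm c] P)))
| red_free σ c P :
    closed_config σ (PFree (Nm c) P) -> closed_config σ.[c <- Bot] P ->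
    σ.[? c] = Some Top ->
    red σ (PFree (Nm c) P) σ.[c <- Bot] P
| red_ctx C σ P σ'' P'' σ1 P1 σ2 P2 :
    closed_config σ1 P1 -> closed_config σ2 P2 ->
    red σ P σ'' P'' ->
    plug C σ P = Some (σ1, P1) ->
    plug C σ'' P'' = Some (σ2, P2) ->
    red σ1 P1 σ2 P2
| red_struct σ σ' P P1 Q1 Q :
    closed_config σ P -> closed_config σ' Q ->
    sc P P1 -> red σ P1 σ' Q1 -> sc Q1 Q ->
    red σ P σ' Q.

Inductive attr : Type :=
| Aff
| Un
| Uniq (i : nat).  (* •_i : unique after i steps *)

Inductive ty : Type :=
| TCh (Ts : list ty) (a : attr)
| TProc.

Inductive key : Type :=
| KId (u : ident)
| KPV (X : nat).

(* typing environments: finite multisets of assumptions, represented as lists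
   taken up to permutation (rule [typ_perm]) *)
Definition env := list (key * ty).

Definition keys (G : env) : list key := List.map fst G.

(* Γ, u:[Ts]^{a-1} : the assumptions to add (None when a = •_0) *)
Definition decr (k : key) (Ts : list ty) (a : attr) : option env :=
  match a with
  | Aff => Some [::]
  | Un => Some [:: (k, TCh Ts Un)]
  | Uniq 0 => None
  | Uniq (S i) => Some [:: (k, TCh Ts (Uniq i))]
  end.

Inductive split : ty -> ty -> ty -> Prop :=
| split_un Ts : split (TCh Ts Un) (TCh Ts Un) (TCh Ts Un)
| split_proc : split TProc TProc TProc
| split_uniq Ts i : split (TCh Ts (Uniq i)) (TCh Ts Aff) (TCh Ts (Uniq (S i))).

Inductive sub_attr : attr -> attr -> Prop :=
| sub_uu i : sub_attr (Uniq i) (Uniq (S i))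
| sub_u_un i : sub_attr (Uniq (S i)) Un
| sub_un_aff : sub_attr Un Aff.

Inductive subty : ty -> ty -> Prop :=
| subty_ch Ts a1 a2 : sub_attr a1 a2 -> subty (TCh Ts a1) (TCh Ts a2).

Definition unr_ty (T : ty) : Prop :=
  match T with TCh _ Un => True | TProc => True | _ => False end.
Definition unr (G : env) : Prop := List.Forall (fun a => unr_ty (snd a)) G.

Inductive typ : env -> proc -> Prop :=
| typ_inp G u Ts a D xs P :
    decr (KId u) Ts a = Some D ->
    List.length xs = List.length Ts ->
    List.NoDup xs ->
    (forall x, List.In x xs ->
       ~ List.In x (fvars P) /\ FV x <> u /\ ~ List.In (KId (FV x)) (keys G)) ->
    typ (G ++ D ++ List.combine (List.map (fun x => KId (FV x)) xs) Ts)
        (open (List.map FV xs) P) ->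
    typ (G ++ [:: (KId u, TCh Ts a)]) (PInp u (List.length xs) P)
| typ_out G u Ts a D vs P :
    decr (KId u) Ts a = Some D ->
    List.length vs = List.length Ts ->
    typ (G ++ D) P ->
    typ (G ++ [:: (KId u, TCh Ts a)] ++ List.combine (List.map KId vs) Ts)
        (POut u vs P)
| typ_par G1 G2 P Q :
    typ G1 P -> typ G2 Q -> typ (G1 ++ G2) (PPar P Q)
| typ_if G u v P Q :
    List.In (KId u) (keys G) -> List.In (KId v) (keys G) ->
    typ G P -> typ G Q -> typ G (PIf u v P Q)
| typ_rec G X P :
    unr G ->
    ~ List.In X (fpvars P) -> ~ List.In (KPV X) (keys G) ->
    typ (G ++ [:: (KPV X, TProc)]) (pvsubst (PVar (PFV X)) P) ->
    typ G (PRec P)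
| typ_var X : typ [:: (KPV X, TProc)] (PVar (PFV X))
| typ_alloc G x Ts P :
    ~ List.In x (fvars P) -> ~ List.In (KId (FV x)) (keys G) ->
    typ (G ++ [:: (KId (FV x), TCh Ts (Uniq 0))]) (open [:: FV x] P) ->
    typ G (PAlloc P)
| typ_free G u Ts P :
    typ G P -> typ (G ++ [:: (KId u, TCh Ts (Uniq 0))]) (PFree u P)
| typ_nil : typ [::] PNil
| typ_nu_top G c T P :
    ~ List.In c (fnames P) -> ~ List.In (KId (Nm c)) (keys G) ->
    typ (G ++ [:: (KId (Nm c), T)]) (open [:: Nm c] P) ->
    typ G (PNu Top P)
| typ_nu_bot G c P :
    ~ List.In c (fnames P) -> ~ List.In (KId (Nm c)) (keys G) ->
    typ G (open [:: Nm c] P) ->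
    typ G (PNu Bot P)
| typ_split G k T T1 T2 P :
    split T T1 T2 ->
    typ (G ++ [:: (k, T1); (k, T2)]) P -> typ (G ++ [:: (k, T)]) P
| typ_weak G k T P :
    typ G P -> typ (G ++ [:: (k, T)]) P
| typ_sub G k T1 T2 P :
    typ (G ++ [:: (k, T2)]) P -> subty T1 T2 -> typ (G ++ [:: (k, T1)]) P
| typ_bullet0 G k Ts1 Ts2 P :
    typ (G ++ [:: (k, TCh Ts2 (Uniq 0))]) P -> typ (G ++ [:: (k, TCh Ts1 (Uniq 0))]) P
| typ_perm G G' P :
    Permutation G G' -> typ G P -> typ G' P.

Definition conf_typ (G : env) (σ : state) (P : proc) : Prop :=
  (forall c, List.In (KId (Nm c)) (keys G) -> σ.[? c] = Some Top) /\
  typ G P /\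
  List.NoDup (keys G).

(* Main.v *)
(* Inside a derivation an assumption may have been split into many, so reduction
   is analysed relative to a functional environment G that refines (via the
   structural rules) the multiset [H ++ F] actually used, where H types the
   reducing process and F its context.  For a single assumption c : T one can
   describe exactly the multisets of types it refines to: from [Uniq i] one gets
   either unrestricted and affine assumptions only, or n affine ones together
   with one [Uniq j], j >= i + n, all sharing the same object types (which differ
   from those of T only if i = 0).  Hence the two endpoints of a
   communication agree on the object types and decrementing both leaves G itself
   a valid environment, while the assumption used by [free] is the only one left
   on its channel, which can be removed from G.  The remaining cases follow from
   a simultaneous substitution lemma and from the invariance of typing under
   structural equivalence. *)
Require Import Defs.
From mathcomp Require Import all_boot finmap zify.
From Stdlib Require Import Arith List Permutation Lia.
Import ListNotations.
Local Open Scope list_scope.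

Set Implicit Arguments.
Unset Strict Implicit.
Unset Printing Implicit Defensive.
Unset SsrRewrite.
Set Bullet Behavior "Strict Subproofs".

(** Preservation fails for arbitrary multisets: assumptions [c : [T]^un] and [c : [T']^un] with
    unrelated object types would let a receiver be fed values of the wrong type. The share [H] alone
    is such a multiset, so the functional [G] and the context's share [F] travel with it through
    every context; a restriction adds its name to [G] on the way in and removes it on the way out.

    The typing rules ask for some fresh identifier at a binder, so a derivation fixes one particular
    choice. Renaming is recovered from a single substitution theorem whose induction renames bound
    identifiers and substitutes at the same time. Opening, closing, index maps and unfolding all
    become instances of one operation [psub], so that their interaction reduces to composition and a
    pointwise comparison.

    Structural equivalence is defined on raw terms with dangling indices, where opening does not
    undo [shift]. Its invariance proof therefore ranges over substitution instances and asks for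
    local closure. *)

Lemma cat_app T : @cat T = @app T.
Proof. reflexivity. Qed.

(** * Simultaneous substitution *)

Definition id_shift (n : nat) (u : ident) : ident :=
  match u with BV i => BV (n + i) | _ => u end.

Definition id_up (n : nat) (f : ident -> ident) (u : ident) : ident :=
  match u with
  | BV i => if i <? n then BV i else id_shift n (f (BV (i - n)))
  | _ => id_shift n (f u)
  end.

(** Only a bare bound process variable is lifted. The images composed below are variables or locally
    closed processes, and on the latter lifting is the identity. *)
Definition pv_shift (R : proc) : proc :=
  match R with PVar (PBV i) => PVar (PBV (S i)) | _ => R end.

Definition pv_up (g : pvar -> proc) (X : pvar) : proc :=
  match X with
  | PBV 0 => PVar (PBV 0)
  | PBV (S i) => pv_shift (g (PBV i))
  | PFV _ => pv_shift (g X)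
  end.

(* Images of process variables are inserted without lifting their bound
   identifiers, as in [pvopen]. *)
Fixpoint psub (f : ident -> ident) (g : pvar -> proc) (P : proc) : proc :=
  match P with
  | POut u vs P => POut (f u) (map f vs) (psub f g P)
  | PInp u n P => PInp (f u) n (psub (id_up n f) g P)
  | PNil => PNil
  | PIf u v P Q => PIf (f u) (f v) (psub f g P) (psub f g Q)
  | PRec P => PRec (psub f (pv_up g) P)
  | PVar X => g X
  | PPar P Q => PPar (psub f g P) (psub f g Q)
  | PNu s P => PNu s (psub (id_up 1 f) g P)
  | PAlloc P => PAlloc (psub (id_up 1 f) g P)
  | PFree u P => PFree (f u) (psub f g P)
  end.

(** Every bound index counts as free. Telling which ones dangle would mean tracking the depth, and
    the substitutions compared below agree on all indices anyway. *)
Definition id_free (u : ident) (P : proc) : Prop :=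
  match u with
  | BV _ => True
  | FV x => In x (fvars P)
  | Nm c => In c (fnames P)
  end.

Definition pv_free (X : pvar) (P : proc) : Prop :=
  match X with PBV _ => True | PFV Y => In Y (fpvars P) end.

Lemma id_up_ext n f f' u :
  (forall i, f (BV i) = f' (BV i)) -> f u = f' u -> id_up n f u = id_up n f' u.
Proof.
  intros Hb Hu; destruct u; simpl; [destruct (_ <? _)| |]; congruence.
Qed.

Lemma pv_up_ext g g' X :
  (forall i, g (PBV i) = g' (PBV i)) -> g X = g' X -> pv_up g X = pv_up g' X.
Proof. intros Hb Hu; destruct X as [[|i]|Y]; simpl; congruence. Qed.

Lemma id_free_out u0 u vs P :
  id_free u0 (POut u vs P) <->
  (match u0 with BV _ => True | _ => False end \/ u0 = u \/ In u0 vs \/ id_free u0 P).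
Proof.
  destruct u0; simpl; rewrite ?cat_app, ?in_app_iff, ?in_flat_map; [tauto| |];
    (split; [intros [H|[[v [Hv H]]|H]]|intros [[]|[H|[H|H]]]]);
    try (destruct u; simpl in H; intuition congruence);
    try (destruct v; simpl in H; intuition congruence);
    subst; simpl; auto; right; left; eexists; split; eauto; simpl; auto.
Qed.

Lemma psub_ext P f f' g g' :
  (forall u, id_free u P -> f u = f' u) ->
  (forall X, pv_free X P -> g X = g' X) ->
  psub f g P = psub f' g' P.
Proof.
  assert (Hid : forall u0, match u0 with
      BV _ => True | FV x => In x (id_vars u0) | Nm c => In c (id_names u0) end)
    by (intros []; simpl; auto).
  revert f f' g g'.
  induction P as [u vs P IH|u n P IH| |u v P IHP Q IHQ|P IH|X|P IHP Q IHQ|s P IH|P IH|u P IH];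
    intros f f' g g' Hf Hg; simpl.
  - f_equal; [|apply map_ext_in; intros v Hv|apply IH; auto];
      try (intros; apply Hf, id_free_out; tauto).
  - f_equal; [apply Hf; specialize (Hid u); destruct u; simpl in *; rewrite ?cat_app, ?in_app_iff; auto|].
    apply IH; auto. intros w Hw; apply id_up_ext; [intros; apply Hf; exact I|].
    apply Hf; destruct w; simpl in *; rewrite ?cat_app, ?in_app_iff; auto.
  - reflexivity.
  - f_equal; [apply Hf; specialize (Hid u)|apply Hf; specialize (Hid v)|apply IHP|apply IHQ];
      try (destruct u; destruct v; simpl in *; rewrite ?cat_app, ?in_app_iff; tauto);
      intros w Hw; [apply Hf|apply Hg|apply Hf|apply Hg]; destruct w; simpl in *;
        rewrite ?cat_app, ?in_app_iff; auto.
  - f_equal; apply IH; auto.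
    intros X HX; apply pv_up_ext; [intros; apply Hg; exact I|].
    apply Hg; destruct X; auto.
  - apply Hg; destruct X; simpl; auto.
  - f_equal; [apply IHP|apply IHQ];
      intros w Hw; [apply Hf|apply Hg|apply Hf|apply Hg]; destruct w; simpl in *;
        rewrite ?cat_app, ?in_app_iff; auto.
  - f_equal; apply IH; auto.
    intros w Hw; apply id_up_ext; [intros; apply Hf; exact I|apply Hf; destruct w; auto].
  - f_equal; apply IH; auto.
    intros w Hw; apply id_up_ext; [intros; apply Hf; exact I|apply Hf; destruct w; auto].
  - f_equal; [apply Hf; specialize (Hid u); destruct u; simpl in *; rewrite ?cat_app, ?in_app_iff; auto|].
    apply IH; auto.
    intros w Hw; apply Hf; destruct w; simpl in *; rewrite ?cat_app, ?in_app_iff; auto.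
Qed.

Lemma id_up_comp n f f' u : id_up n f (id_up n f' u) = id_up n (fun v => f (f' v)) u.
Proof.
  assert (H : forall v, id_up n f (id_shift n v) = id_shift n (f v)).
  { intros [i|x|c]; simpl; auto. destruct (Nat.ltb_spec (n + i) n); [lia|].
    replace (n + i - n) with i by lia; auto. }
  destruct u; simpl; auto.
  destruct (Nat.ltb_spec i n); simpl; auto.
  destruct (Nat.ltb_spec i n); auto; lia.
Qed.

Lemma id_up_id n u : id_up n (fun v => v) u = u.
Proof.
  destruct u; simpl; auto. destruct (Nat.ltb_spec i n); auto. f_equal; lia.
Qed.

Lemma id_up_up n k f u : id_up n (id_up k f) u = id_up (k + n) f u.
Proof.
  assert (H : forall v, id_shift n (id_shift k v) = id_shift (k + n) v)
    by (intros []; simpl; f_equal; lia).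
  destruct u; simpl; auto.
  destruct (Nat.ltb_spec i n), (Nat.ltb_spec i (k + n)); simpl; auto; try lia;
    destruct (Nat.ltb_spec (i - n) k); simpl; try lia; try (f_equal; lia).
  rewrite H; do 3 f_equal; lia.
Qed.

Definition id_fixing (f : ident -> ident) : Prop :=
  (forall x, f (FV x) = FV x) /\ (forall c, f (Nm c) = Nm c).
Definition pv_fixing (g : pvar -> proc) : Prop :=
  forall X, g (PFV X) = PVar (PFV X).

Lemma id_fixing_up n f : id_fixing f -> id_fixing (id_up n f).
Proof. intros [H1 H2]; split; intros; simpl; rewrite ?H1, ?H2; auto. Qed.

Lemma pv_fixing_up g : pv_fixing g -> pv_fixing (pv_up g).
Proof. intros H X; simpl; rewrite H; auto. Qed.

Lemma psub_lc_at P k kp f g :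
  lc_at k kp P ->
  id_fixing f -> (forall i, i < k -> f (BV i) = BV i) ->
  pv_fixing g -> (forall i, i < kp -> g (PBV i) = PVar (PBV i)) ->
  psub f g P = P.
Proof.
  assert (Hid : forall k f u, id_lc k u -> id_fixing f -> (forall i, i < k -> f (BV i) = BV i) -> f u = u).
  { intros k0 f0 [] Hl [H1 H2] H3; simpl in *; auto. }
  assert (Hup : forall k n f, (forall i, i < k -> f (BV i) = BV i) ->
      forall i, i < k + n -> id_up n f (BV i) = BV i).
  { intros k0 n f0 H i Hi; simpl. destruct (Nat.ltb_spec i n); auto.
    rewrite H by lia. simpl; f_equal; lia. }
  revert k kp f g.
  induction P as [u vs P IH|u n P IH| |u v P IHP Q IHQ|P IH|X|P IHP Q IHQ|s P IH|P IH|u P IH];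
    intros k kp f g Hl Hf Hfb Hg Hgb; simpl in *.
  - destruct Hl as (Hu & Hvs & Hl). f_equal; eauto.
    rewrite <- (map_id vs) at 2. apply map_ext_in; intros v Hv.
    rewrite Forall_forall in Hvs; eauto.
  - destruct Hl as (Hu & Hl). f_equal; eauto using id_fixing_up.
  - reflexivity.
  - destruct Hl as (Hu & Hv & HP & HQ); f_equal; eauto.
  - f_equal. eapply IH; eauto using pv_fixing_up.
    intros [|i] Hi; simpl; auto. rewrite Hgb by lia; auto.
  - destruct X; auto.
  - destruct Hl; f_equal; eauto.
  - f_equal; eapply IH; eauto using id_fixing_up. intros i Hi; apply (Hup k 1 f); auto; lia.
  - f_equal; eapply IH; eauto using id_fixing_up. intros i Hi; apply (Hup k 1 f); auto; lia.
  - destruct Hl; f_equal; eauto.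
Qed.

Lemma psub_lc P f g : lc P -> id_fixing f -> pv_fixing g -> psub f g P = P.
Proof. intros Hl Hf Hg; eapply psub_lc_at; eauto; intros i Hi; lia. Qed.

(** Under a binder [f] becomes [id_up n f], whereas the images of [g'] are inserted as they are. The
    two sides still agree if an image contains no identifier at all (a bare variable), or if it is
    locally closed and [f], [g] fix everything free. *)
Lemma psub_comp P f g f' g' :
  (forall X, (exists Y, g' X = PVar Y) \/ (lc (g' X) /\ id_fixing f /\ pv_fixing g)) ->
  psub f g (psub f' g' P) = psub (fun u => f (f' u)) (fun X => psub f g (g' X)) P.
Proof.
  assert (Hup : forall n f g (g' : pvar -> proc),
    (forall X, (exists Y, g' X = PVar Y) \/ (lc (g' X) /\ id_fixing f /\ pv_fixing g)) ->
    (forall X, (exists Y, g' X = PVar Y) \/ (lc (g' X) /\ id_fixing (id_up n f) /\ pv_fixing g)) /\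
    forall X, psub (id_up n f) g (g' X) = psub f g (g' X)).
  { intros n f0 g0 g1 H; split; intros X; destruct (H X) as [[Y HY]|(H1 & H2 & H3)].
    - left; eauto.
    - right; auto using id_fixing_up.
    - rewrite HY; auto.
    - rewrite !psub_lc; auto using id_fixing_up. }
  revert f g f' g'.
  induction P as [u vs P IH|u n P IH| |u v P IHP Q IHQ|P IH|X|P IHP Q IHQ|s P IH|P IH|u P IH];
    intros f g f' g' H; simpl.
  - rewrite map_map, IH; auto.
  - destruct (Hup n f g g' H) as [H1 H2].
    rewrite IH; auto. f_equal. apply psub_ext; intros; auto using id_up_comp.
  - auto.
  - rewrite IHP, IHQ; auto.
  - rewrite IH.
    + f_equal; apply psub_ext; auto. intros [[|i]|Y] _; simpl; auto;
        [destruct (H (PBV i)) as [[Z HZ]|(H1 & H2 & H3)]|destruct (H (PFV Y)) as [[Z HZ]|(H1 & H2 & H3)]].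
      * rewrite HZ; destruct Z; auto.
      * rewrite (@psub_lc _ f g); auto.
        replace (pv_shift (g' (PBV i))) with (g' (PBV i)).
        { apply psub_lc; auto using pv_fixing_up. }
        destruct (g' (PBV i)) as [| | | | |[j|Y]| | | |]; auto. unfold lc in H1; simpl in H1; lia.
      * rewrite HZ; destruct Z; auto.
      * rewrite (@psub_lc _ f g); auto.
        replace (pv_shift (g' (PFV Y))) with (g' (PFV Y)).
        { apply psub_lc; auto using pv_fixing_up. }
        destruct (g' (PFV Y)) as [| | | | |[j|Z]| | | |]; auto. unfold lc in H1; simpl in H1; lia.
    + assert (Hs : forall R, (exists Y, R = PVar Y) \/ (lc R /\ id_fixing f /\ pv_fixing g) ->
        (exists Y, pv_shift R = PVar Y) \/ (lc (pv_shift R) /\ id_fixing f /\ pv_fixing (pv_up g))).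
      { intros R [[Y ->]|(H1 & H2 & H3)]; [left; destruct Y; simpl; eauto|].
        destruct R as [| | | | |[j|Z]| | | |]; simpl; eauto 6 using pv_fixing_up. }
      intros [[|i]|Y]; simpl; eauto.
  - auto.
  - rewrite IHP, IHQ; auto.
  - destruct (Hup 1 f g g' H) as [H1 H2].
    rewrite IH; auto. f_equal. apply psub_ext; intros; auto using id_up_comp.
  - destruct (Hup 1 f g g' H) as [H1 H2].
    rewrite IH; auto. f_equal. apply psub_ext; intros; auto using id_up_comp.
  - rewrite IH; auto.
Qed.

Lemma psub_id P : psub (fun u => u) PVar P = P.
Proof.
  induction P as [u vs P IH|u n P IH| |u v P IHP Q IHQ|P IH|X|P IHP Q IHQ|s P IH|P IH|u P IH];
    simpl; try congruence.
  - rewrite map_id; congruence.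
  - f_equal; rewrite <- IH at 2; apply psub_ext; auto using id_up_id.
  - f_equal; rewrite <- IH at 2; apply psub_ext; auto. intros [[|i]|Y]; auto.
  - f_equal; rewrite <- IH at 2; apply psub_ext; auto using id_up_id.
  - f_equal; rewrite <- IH at 2; apply psub_ext; auto using id_up_id.
Qed.

(* As with [popen], indices beyond [us] are left as they are, not decremented. *)
Definition id_inst (us : list ident) (u : ident) : ident :=
  match u with BV i => nth i us (BV i) | _ => u end.

Definition pv_inst (R : proc) (X : pvar) : proc :=
  match X with PBV 0 => R | _ => PVar X end.

Definition id_bind (c : nat) (u : ident) : ident :=
  match u with Nm d => if Nat.eqb d c then BV 0 else u | _ => u end.

Definition id_reindex (h : nat -> nat) (u : ident) : ident :=
  match u with BV i => BV (h i) | _ => u end.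

(** [id_up] lifts images and [popen] does not; local closure of [us] makes the two coincide. *)
Lemma popen_psub us P k :
  Forall (id_lc 0) us -> popen k us P = psub (id_up k (id_inst us)) PVar P.
Proof.
  intros Hus.
  assert (Hid : forall k u, id_open k us u = id_up k (id_inst us) u).
  { intros k0 [i|x|c]; simpl; auto.
    destruct (Nat.ltb_spec i k0), (Nat.leb_spec k0 i); auto; try lia.
    destruct (Nat.lt_ge_cases (i - k0) (length us)) as [Hi|Hi].
    - rewrite Forall_forall in Hus.
      assert (Hin := Hus _ (nth_In _ (BV i) Hi)).
      rewrite (nth_indep _ (BV (i - k0)) (BV i)) by auto.
      destruct (nth (i - k0) us (BV i)); simpl in *; auto; lia.
    - rewrite !nth_overflow by lia. simpl; f_equal; lia. }
  revert k.
  induction P as [u vs P IH|u n P IH| |u v P IHP Q IHQ|P IH|X|P IHP Q IHQ|s P IH|P IH|u P IH];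
    intros k; simpl; rewrite ?Hid, ?IH, ?IHP, ?IHQ; auto.
  - f_equal. apply map_ext; auto.
  - f_equal. apply psub_ext; auto. intros; symmetry; apply id_up_up.
  - f_equal. apply psub_ext; auto. intros [[|i]|Y]; auto.
  - f_equal. apply psub_ext; auto. intros; symmetry; rewrite id_up_up; f_equal; lia.
  - f_equal. apply psub_ext; auto. intros; symmetry; rewrite id_up_up; f_equal; lia.
Qed.

Lemma id_up0 f u : id_up 0 f u = f u.
Proof. destruct u; simpl; rewrite ?subn0; destruct (f _); auto. Qed.

Lemma open_psub us P : Forall (id_lc 0) us -> open us P = psub (id_inst us) PVar P.
Proof.
  intros H; unfold open; rewrite popen_psub by auto.
  apply psub_ext; auto using id_up0.
Qed.

Lemma pclose_psub c P k : pclose k c P = psub (id_up k (id_bind c)) PVar P.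
Proof.
  assert (Hid : forall k u, id_close k c u = id_up k (id_bind c) u).
  { intros k0 [i|x|d]; simpl; auto.
    - destruct (Nat.ltb_spec i k0); auto. simpl; f_equal; lia.
    - destruct (Nat.eqb d c); simpl; auto; f_equal; lia. }
  revert k.
  induction P as [u vs P IH|u n P IH| |u v P IHP Q IHQ|P IH|X|P IHP Q IHQ|s P IH|P IH|u P IH];
    intros k; simpl; rewrite ?Hid, ?IH, ?IHP, ?IHQ; auto.
  - f_equal. apply map_ext; auto.
  - f_equal. apply psub_ext; auto. intros; symmetry; apply id_up_up.
  - f_equal. apply psub_ext; auto. intros [[|i]|Y]; auto.
  - f_equal. apply psub_ext; auto. intros; symmetry; rewrite id_up_up; f_equal; lia.
  - f_equal. apply psub_ext; auto. intros; symmetry; rewrite id_up_up; f_equal; lia.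
Qed.

Lemma bvmap_psub h P k : bvmap h k P = psub (id_up k (id_reindex h)) PVar P.
Proof.
  assert (Hid : forall k u, id_bvmap h k u = id_up k (id_reindex h) u) by (intros k0 []; simpl; auto).
  revert k.
  induction P as [u vs P IH|u n P IH| |u v P IHP Q IHQ|P IH|X|P IHP Q IHQ|s P IH|P IH|u P IH];
    intros k; simpl; rewrite ?Hid, ?IH, ?IHP, ?IHQ; auto.
  - f_equal. apply map_ext; auto.
  - f_equal. apply psub_ext; auto. intros; symmetry; apply id_up_up.
  - f_equal. apply psub_ext; auto. intros [[|i]|Y]; auto.
  - f_equal. apply psub_ext; auto. intros; symmetry; rewrite id_up_up; f_equal; lia.
  - f_equal. apply psub_ext; auto. intros; symmetry; rewrite id_up_up; f_equal; lia.
Qed.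

Fixpoint pv_ups (k : nat) (g : pvar -> proc) : pvar -> proc :=
  match k with 0 => g | S k => pv_up (pv_ups k g) end.

(** [pvopen] goes under recursion binders without lifting [R], while [psub] applies [pv_shift]
    there. The hypothesis holds for [PRec] processes and for free process variables, the two cases
    in use. *)
Lemma pvopen_psub R P k :
  pv_shift R = R -> pvopen k R P = psub (fun u => u) (pv_ups k (pv_inst R)) P.
Proof.
  intros HR. revert k.
  induction P as [u vs P IH|u n P IH| |u v P IHP Q IHQ|P IH|X|P IHP Q IHQ|s P IH|P IH|u P IH];
    intros k; simpl; rewrite ?map_id, ?IH, ?IHP, ?IHQ; auto;
    try (f_equal; apply psub_ext; intros; rewrite ?id_up_id; auto; fail).
  induction k as [|k IHk] in X |- *; simpl.
  - destruct X as [[|i]|Y]; auto.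
  - destruct X as [[|i]|Y]; simpl; auto.
    + rewrite <- (IHk (PBV i)). destruct (Nat.eqb i k); auto.
    + rewrite <- (IHk (PFV Y)); auto.
Qed.

Lemma pvsubst_psub R P :
  pv_shift R = R -> pvsubst R P = psub (fun u => u) (pv_inst R) P.
Proof. exact (@pvopen_psub R P 0). Qed.

Lemma ident_eq_dec (u v : ident) : {u = v} + {u <> v}.
Proof. decide equality; apply Nat.eq_dec. Qed.

Lemma key_eq_dec (k l : key) : {k = l} + {k <> l}.
Proof. decide equality; [apply ident_eq_dec|apply Nat.eq_dec]. Qed.

Definition keyb (k l : key) : bool := if key_eq_dec k l then true else false.

Definition at_key (k : key) (G : env) : env := filter (fun a => keyb (fst a) k) G.
Definition off_key (k : key) (G : env) : env := filter (fun a => negb (keyb (fst a) k)) G.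

(** * Structural refinement of environments *)

Inductive item_step : ty -> list ty -> Prop :=
| step_split T T1 T2 : Defs.split T T1 T2 -> item_step T [T1; T2]
| step_weak T : item_step T []
| step_sub T1 T2 : subty T1 T2 -> item_step T1 [T2]
| step_bullet0 Ts1 Ts2 : item_step (TCh Ts1 (Uniq 0)) [TCh Ts2 (Uniq 0)].

(* The structural rules read backwards: [ref G H] when [typ G P] follows from
   [typ H P] by structural rules only. *)
Inductive ref : env -> env -> Prop :=
| ref_perm G G' : Permutation G G' -> ref G G'
| ref_step G k T L : item_step T L -> ref (G ++ [(k, T)]) (G ++ map (pair k) L)
| ref_trans G1 G2 G3 : ref G1 G2 -> ref G2 G3 -> ref G1 G3.

Lemma ref_refl G : ref G G.
Proof. apply ref_perm; auto. Qed.

Lemma typ_ref G H P : ref G H -> typ H P -> typ G P.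
Proof.
  induction 1 as [G G' Hp|G k T L Hs|G1 G2 G3 _ IH1 _ IH2]; intros HP; auto.
  - eapply typ_perm; [symmetry; eassumption|auto].
  - rewrite <- cat_app in *. destruct Hs; simpl in *.
    + eapply typ_split; eauto.
    + rewrite cats0 in HP. apply typ_weak; auto.
    + eapply typ_sub; eauto.
    + eapply typ_bullet0; eauto.
Qed.

Lemma ref_app_l F G H : ref G H -> ref (F ++ G) (F ++ H).
Proof.
  induction 1 as [G G' Hp|G k T L Hs|G1 G2 G3 _ IH1 _ IH2].
  - apply ref_perm, Permutation_app_head; auto.
  - rewrite !app_assoc; apply ref_step; auto.
  - eapply ref_trans; eauto.
Qed.

Lemma ref_app_comm G H : ref (G ++ H) (H ++ G).
Proof. apply ref_perm, Permutation_app_comm. Qed.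

Lemma ref_app G G' H H' : ref G G' -> ref H H' -> ref (G ++ H) (G' ++ H').
Proof.
  intros H1 H2. eapply ref_trans; [apply ref_app_l; eassumption|].
  eapply ref_trans; [apply ref_app_comm|].
  eapply ref_trans; [apply ref_app_l; eassumption|].
  apply ref_app_comm.
Qed.

Lemma ref_nil G : ref G [].
Proof.
  induction G as [|[k T] G IH] using rev_ind; [apply ref_refl|].
  eapply ref_trans; [|exact IH].
  rewrite <- (app_nil_r G) at 2. exact (ref_step G k (step_weak T)).
Qed.

Lemma ref_drop_r G H : ref (G ++ H) G.
Proof. rewrite <- (app_nil_r G) at 2. apply ref_app_l, ref_nil. Qed.

Lemma ref_drop_l G H : ref (G ++ H) H.
Proof. eapply ref_trans; [apply ref_app_comm|apply ref_drop_r]. Qed.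

Lemma keys_app G H : keys (G ++ H) = keys G ++ keys H.
Proof. apply map_app. Qed.

Lemma ref_keys G H k : ref G H -> In k (keys H) -> In k (keys G).
Proof.
  induction 1 as [G G' Hp|G l T L Hs|G1 G2 G3 _ IH1 _ IH2]; auto.
  - apply Permutation_in, Permutation_map; symmetry; auto.
  - rewrite !keys_app, !in_app_iff. intros [Hk|Hk]; auto. right; simpl.
    unfold keys in Hk; rewrite map_map in Hk. apply in_map_iff in Hk as (x & <- & _); auto.
Qed.

Lemma filter_perm {A} (p : A -> bool) (l l' : list A) :
  Permutation l l' -> Permutation (filter p l) (filter p l').
Proof.
  induction 1; simpl; auto.
  - destruct (p x); auto.
  - destruct (p x), (p y); auto; apply perm_swap.
  - eapply perm_trans; eauto.
Qed.

(** Each structural step stays on one key, so a filter on keys keeps it or erases it as a whole. *)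
Lemma ref_filter (p : key -> bool) G H :
  ref G H -> ref (filter (fun a => p (fst a)) G) (filter (fun a => p (fst a)) H).
Proof.
  induction 1 as [G G' Hp|G k T L Hs|G1 G2 G3 _ IH1 _ IH2].
  - apply ref_perm, filter_perm; auto.
  - rewrite !filter_app; simpl. destruct (p k) eqn:E.
    + replace (filter _ (map (pair k) L)) with (map (pair k) L); [apply ref_step; auto|].
      clear Hs; induction L; simpl; rewrite ?E; congruence.
    + replace (filter _ (map (pair k) L)) with (@nil (key * ty)); [apply ref_refl|].
      clear Hs; induction L; simpl; rewrite ?E; congruence.
  - eapply ref_trans; eauto.
Qed.

Lemma ref_at_key k G H : ref G H -> ref (at_key k G) (at_key k H).
Proof. exact (@ref_filter (fun l => keyb l k) G H). Qed.

Lemma ref_off_key k G H : ref G H -> ref (off_key k G) (off_key k H).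
Proof. exact (@ref_filter (fun l => negb (keyb l k)) G H). Qed.

Lemma off_at_key_perm k G : Permutation G (off_key k G ++ at_key k G).
Proof.
  induction G as [|[l T] G IH]; simpl; auto.
  unfold keyb; destruct (key_eq_dec l k); simpl; auto.
  apply Permutation_cons_app; auto.
Qed.

Lemma off_key_notin k G : ~ In k (keys G) -> off_key k G = G.
Proof.
  induction G as [|[l T] G IH]; simpl; auto. intros H.
  unfold keyb; destruct (key_eq_dec l k); simpl; [tauto|]. f_equal; apply IH; tauto.
Qed.

Lemma at_key_notin k G : ~ In k (keys G) -> at_key k G = [].
Proof.
  induction G as [|[l T] G IH]; simpl; auto. intros H.
  unfold keyb; destruct (key_eq_dec l k); simpl; [tauto|]. apply IH; tauto.
Qed.

Lemma in_keys_off_key k l G : In l (keys (off_key k G)) <-> In l (keys G) /\ l <> k.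
Proof.
  induction G as [|[m T] G IH]; simpl; [tauto|].
  unfold keyb; destruct (key_eq_dec m k); simpl; rewrite IH; intuition congruence.
Qed.

Lemma unr_dup G : unr G -> ref G (G ++ G).
Proof.
  induction 1 as [|[k T] G HT _ IH]; [apply ref_refl|]. simpl in HT.
  change ((k, T) :: G) with ([(k, T)] ++ G).
  apply ref_trans with ([(k, T); (k, T)] ++ (G ++ G)).
  - apply ref_app; auto. apply (@ref_step [] k T [T; T]), step_split.
    destruct T as [Ts []|]; try contradiction; constructor.
  - apply ref_perm; simpl. constructor. apply Permutation_middle.
Qed.

(** * Inversion of typing up to structural rules *)

Definition nu_env (s : st) (c : nat) (T : ty) : env :=
  match s with Top => [(KId (Nm c), T)] | Bot => [] end.

Lemma typ_nu G s c T P :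
  ~ In c (fnames P) -> ~ In (KId (Nm c)) (keys G) ->
  typ (G ++ nu_env s c T) (open [Nm c] P) -> typ G (PNu s P).
Proof.
  rewrite <- cat_app. destruct s; simpl; intros H1 H2 H3.
  - eapply typ_nu_top; eauto.
  - rewrite cats0 in H3. eapply typ_nu_bot; eauto.
Qed.

(** Describes the last syntax-directed rule of a derivation; the structural rules applied after it
    are collected in the [ref] of [typ_inv]. With [nu_env], the two rules for restriction take the
    same form. *)
Definition rule_premises (G : env) (P : proc) : Prop :=
  match P with
  | POut u vs P => exists G0 Ts a D,
      G = G0 ++ [(KId u, TCh Ts a)] ++ combine (map KId vs) Ts /\
      decr (KId u) Ts a = Some D /\ length vs = length Ts /\ typ (G0 ++ D) P
  | PInp u n P => exists G0 Ts a D xs,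
      G = G0 ++ [(KId u, TCh Ts a)] /\ n = length xs /\
      decr (KId u) Ts a = Some D /\ length xs = length Ts /\ NoDup xs /\
      (forall x, In x xs -> ~ In x (fvars P) /\ FV x <> u /\ ~ In (KId (FV x)) (keys G0)) /\
      typ (G0 ++ D ++ combine (map KId (map FV xs)) Ts) (open (map FV xs) P)
  | PIf u v P Q => In (KId u) (keys G) /\ In (KId v) (keys G) /\ typ G P /\ typ G Q
  | PRec P => exists X, unr G /\ ~ In X (fpvars P) /\ ~ In (KPV X) (keys G) /\
      typ (G ++ [(KPV X, TProc)]) (pvsubst (PVar (PFV X)) P)
  | PPar P Q => exists G1 G2, G = G1 ++ G2 /\ typ G1 P /\ typ G2 Q
  | PNu s P => exists c T, ~ In c (fnames P) /\ ~ In (KId (Nm c)) (keys G) /\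
      typ (G ++ nu_env s c T) (open [Nm c] P)
  | PAlloc P => exists x Ts, ~ In x (fvars P) /\ ~ In (KId (FV x)) (keys G) /\
      typ (G ++ [(KId (FV x), TCh Ts (Uniq 0))]) (open [FV x] P)
  | PFree u P => exists G0 Ts, G = G0 ++ [(KId u, TCh Ts (Uniq 0))] /\ typ G0 P
  | PNil | PVar _ => True
  end.

Lemma typ_inv G P : typ G P -> exists H, ref G H /\ rule_premises H P.
Proof.
  induction 1; rewrite ?cat_app in *;
    try (eexists; split; [apply ref_refl|]; simpl; rewrite ?cat_app; eauto 10; fail);
    try (match goal with IH : exists H, ref ?G0 H /\ _ |- exists H', ref ?G H' /\ _ =>
      destruct IH as (K & HK & Hp); exists K; split; auto; eapply ref_trans; [|exact HK] end).
  - eexists; split; [apply ref_refl|]; simpl. do 5 eexists; repeat split; eauto; try apply H2; auto.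
    rewrite map_map; auto.
  (* The type is a dummy, since [nu_env Bot] adds no assumption. *)
  - eexists; split; [apply ref_refl|]; simpl. exists c, TProc; repeat split; eauto.
    rewrite app_nil_r; auto.
  - exact (ref_step G k (step_split H)).
  - apply ref_drop_r.
  - exact (ref_step G k (step_sub H0)).
  - exact (ref_step G k (step_bullet0 Ts1 Ts2)).
  - apply ref_perm; symmetry; auto.
Qed.

(** * Substitution lemma *)

Fixpoint updates (f : ident -> ident) (us vs : list ident) (u : ident) : ident :=
  match us, vs with
  | a :: us, v :: vs => if ident_eq_dec u a then v else updates f us vs u
  | _, _ => f u
  end.

Lemma updates_notin f us vs u : ~ In u us -> updates f us vs u = f u.
Proof.
  revert vs; induction us as [|a us IH]; intros [|v vs]; simpl; auto; intros H.
  destruct (ident_eq_dec u a); [subst; exfalso; auto|apply IH; tauto].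
Qed.

Lemma map_updates f us vs : NoDup us -> length us = length vs -> map (updates f us vs) us = vs.
Proof.
  revert vs; induction us as [|a us IH]; intros [|v vs] Hn Hl; simpl in *; auto; try discriminate.
  inversion Hn; subst. destruct (ident_eq_dec a a); [|congruence]. f_equal.
  transitivity (map (updates f us vs) us); [|auto]. apply map_ext_in; intros b Hb.
  destruct (ident_eq_dec b a); [subst; tauto|auto].
Qed.

Definition id_renaming (f : ident -> ident) : Prop :=
  (forall i, f (BV i) = BV i) /\ (forall u, id_lc 0 u -> id_lc 0 (f u)).

Lemma id_renaming_id : id_renaming (fun u => u).
Proof. split; auto. Qed.

Lemma id_renaming_updates f us vs :
  id_renaming f -> Forall (id_lc 0) us -> Forall (id_lc 0) vs -> id_renaming (updates f us vs).
Proof.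
  intros [H1 H2] Hus Hvs; split.
  - intros i; rewrite updates_notin; auto. intros Hi.
    rewrite Forall_forall in Hus. apply Hus in Hi; simpl in Hi; lia.
  - intros u Hu; clear H1 Hus. revert vs Hvs; induction us as [|a us IH]; intros [|v vs] Hvs; simpl; auto.
    inversion Hvs; subst. destruct (ident_eq_dec u a); simpl; auto.
Qed.

Lemma id_inst_lc us u : id_lc 0 u -> id_inst us u = u.
Proof. destruct u; simpl; auto; lia. Qed.

Lemma id_shift_lc n u : id_lc 0 u -> id_shift n u = u.
Proof. destruct u; simpl; auto; lia. Qed.

(** Lets one substitution act as [f] and at the same time rename a binder's identifiers [us] to
    [vs]. As [us] do not occur in [P], overriding [f] on them is visible only at the opened
    indices. *)
Lemma psub_open_updates f g us vs P :
  NoDup us -> length us = length vs -> Forall (id_lc 0) us -> Forall (id_lc 0) vs ->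
  (forall u, In u us -> ~ id_free u P) -> id_renaming f ->
  (forall i, g (PBV i) = PVar (PBV i)) -> (forall X, lc (g (PFV X))) ->
  psub (updates f us vs) g (open us P) = open vs (psub (id_up (length us) f) g P).
Proof.
  intros Hn Hl Hus Hvs Hfr [Hf1 Hf2] Hg1 Hg2.
  assert (Hbv : forall i, ~ In (BV i) us).
  { intros i Hi; rewrite Forall_forall in Hus; apply Hus in Hi; simpl in Hi; lia. }
  assert (Hfix : id_fixing (id_inst vs) /\ pv_fixing PVar) by (repeat split; auto).
  rewrite !open_psub by auto. rewrite !psub_comp.
  - apply psub_ext; simpl.
    + intros [i|x|c] Hu.
      * simpl. destruct (Nat.ltb_spec i (length us)).
        { rewrite <- (map_updates f (us := us) (vs := vs)) at 2 by auto. simpl.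
          rewrite (nth_indep (map _ us) (BV i) (updates f us vs (BV i))) by (rewrite length_map; auto).
          rewrite map_nth; auto. }
        rewrite nth_overflow, updates_notin, !Hf1 by auto. simpl.
        rewrite nth_overflow by lia. f_equal; lia.
      * simpl. rewrite updates_notin by (intros Hi; eapply Hfr; eauto).
        rewrite id_shift_lc, id_inst_lc; auto; apply Hf2; exact I.
      * simpl. rewrite updates_notin by (intros Hi; eapply Hfr; eauto).
        rewrite id_shift_lc, id_inst_lc; auto; apply Hf2; exact I.
    + intros [i|X] _; [rewrite Hg1; auto|symmetry; apply psub_lc; [apply Hg2|tauto|tauto]].
  - intros [i|X]; [rewrite Hg1; eauto|right; split; auto].
  - eauto.
Qed.

Lemma fresh_nats (L : list nat) (n : nat) :
  exists xs, length xs = n /\ NoDup xs /\ forall x, In x xs -> ~ In x L.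
Proof.
  exists (seq (S (list_max L)) n); split; [apply length_seq|split; [apply seq_NoDup|]].
  intros x Hx HL. apply in_seq in Hx.
  assert (H := list_max_le L (list_max L)). destruct H as [H _].
  specialize (H (le_n _)). rewrite Forall_forall in H. apply H in HL. lia.
Qed.

Lemma fresh_nat (L : list nat) : exists x, ~ In x L.
Proof.
  destruct (fresh_nats L 1) as ([|x xs] & Hl & _ & H); [discriminate|].
  exists x; apply H; simpl; auto.
Qed.

(** All sorts of keys share one pool of numbers, so a single fresh number is fresh as a variable, a
    name and a process variable. *)
Definition key_nat (k : key) : nat :=
  match k with KId (BV n) | KId (FV n) | KId (Nm n) | KPV n => n end.

Definition keys_nats (G : env) : list nat := map key_nat (keys G).

Lemma notin_keys_nats k G : ~ In (key_nat k) (keys_nats G) -> ~ In k (keys G).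
Proof. intros H Hk; apply H, in_map; auto. Qed.

(* Assumptions on a process variable at a channel type are never used by a
   derivation, so they are dropped. *)
Definition env_sub (f : ident -> ident) (U : nat -> env) (G : env) : env :=
  flat_map (fun a => match a with
    | (KId u, T) => [(KId (f u), T)]
    | (KPV X, TProc) => U X
    | (KPV _, _) => []
    end) G.

Lemma env_sub_app f U G H : env_sub f U (G ++ H) = env_sub f U G ++ env_sub f U H.
Proof. apply flat_map_app. Qed.

Lemma env_sub_ext f f' U U' G :
  (forall u, In (KId u) (keys G) -> f u = f' u) ->
  (forall X, In (KPV X) (keys G) -> U X = U' X) -> env_sub f U G = env_sub f' U' G.
Proof.
  induction G as [|[[u|X] T] G IH]; simpl; auto; intros H1 H2; rewrite IH; auto.
  - rewrite H1; auto.
  - destruct T; auto. rewrite H2; auto.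
Qed.

Lemma env_sub_combine f U vs Ts :
  env_sub f U (combine (map KId vs) Ts) = combine (map KId (map f vs)) Ts.
Proof. revert Ts; induction vs as [|v vs IH]; intros [|T Ts]; simpl; f_equal; auto. Qed.

Lemma env_sub_keys f U G u : In (KId u) (keys G) -> In (KId (f u)) (keys (env_sub f U G)).
Proof.
  induction G as [|[k T] G IH]; simpl; [tauto|]. rewrite keys_app, in_app_iff.
  intros [->|H]; simpl; auto.
Qed.

Lemma env_sub_unr f U G : (forall X, unr (U X)) -> unr G -> unr (env_sub f U G).
Proof.
  intros HU; induction 1 as [|[[u|X] T] G HT _ IH]; simpl; [constructor|constructor; auto|].
  destruct T; auto. apply Forall_app; split; auto; apply HU.
Qed.

(** Structural steps look only at types, so they survive even an [f] that merges keys. Splitting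
    [TProc] demands two copies of [U X], hence the unrestricted [U]. *)
Lemma env_sub_ref f U G H : (forall X, unr (U X)) -> ref G H -> ref (env_sub f U G) (env_sub f U H).
Proof.
  intros HU; induction 1 as [G G' Hp|G [u|X] T L Hs|G1 G2 G3 _ IH1 _ IH2].
  - apply ref_perm, Permutation_flat_map; auto.
  - rewrite !env_sub_app.
    replace (env_sub f U (map (pair (KId u)) L)) with (map (pair (KId (f u))) L).
    + apply ref_step; auto.
    + clear Hs; induction L; simpl; congruence.
  - rewrite !env_sub_app; apply ref_app_l.
    destruct Hs as [T T1 T2 Hs|T|T1 T2 Hs|Ts1 Ts2]; simpl; try destruct Hs; simpl;
      try apply ref_refl; try apply ref_nil.
    rewrite app_nil_r. apply unr_dup; auto.
  - eapply ref_trans; eauto.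
Qed.

Lemma decr_KId u Ts a D :
  decr (KId u) Ts a = Some D ->
  (forall v, In (KId v) (keys D) -> v = u) /\
  forall f U, decr (KId (f u)) Ts a = Some (env_sub f U D).
Proof.
  destruct a as [| |[|i]]; simpl; intros H; inversion H; subst; split; auto; simpl; intuition congruence.
Qed.

Lemma lc_FV xs : Forall (id_lc 0) (map FV xs).
Proof. induction xs; constructor; simpl; auto. Qed.

Lemma lc_Nm cs : Forall (id_lc 0) (map Nm cs).
Proof. induction cs; constructor; simpl; auto. Qed.

(** Injectivity of [f] is not asked for, because environments are multisets. At each binder the
    identifier chosen by the derivation is redirected to one fresh for the substituted body and the
    new environment, which restores the side conditions of the rule. *)
Theorem typ_psub G P f g U :
  typ G P -> id_renaming f -> (forall i, g (PBV i) = PVar (PBV i)) ->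
  (forall X, lc (g (PFV X)) /\ unr (U X) /\ typ (U X) (g (PFV X))) ->
  typ (env_sub f U G) (psub f g P).
Proof.
  intros HP; revert f g U.
  induction HP; intros f g U Hf Hg HU; rewrite ?cat_app in *;
    assert (HUu : forall X, unr (U X)) by (intros Y; apply HU);
    try (match goal with IH : forall f g U, _ -> _ -> _ -> typ (env_sub f U ?H) (psub f g ?P)
         |- typ (env_sub _ _ ?G) (psub _ _ ?P) =>
           apply typ_ref with (env_sub f U H); [apply env_sub_ref; auto|auto] end).
  - destruct (decr_KId H) as [Hk HD].
    set (n := length xs).
    destruct (fresh_nats (fvars (psub (id_up n f) g P) ++ key_nat (KId (f u)) :: keys_nats (env_sub f U G)) n)
      as (ys & Hl & Hn & Hfr).
    rewrite env_sub_app; simpl. subst n. rewrite <- Hl at 1. rewrite <- cat_app.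
    apply typ_inp with (env_sub f U D); auto; [congruence| |].
    + intros y Hy; apply Hfr in Hy. rewrite in_app_iff in Hy; simpl in Hy.
      repeat split; [tauto| |].
      * intros E; rewrite <- E in Hy; simpl in Hy; tauto.
      * apply notin_keys_nats; simpl; tauto.
    + rewrite !cat_app.
      assert (Hlc := lc_FV).
      assert (HnF : NoDup (map FV xs))
        by (apply NoDup_map_NoDup_ForallPairs; auto; intros a0 b0 _ _ E; congruence).
      rewrite <- (map_map FV KId) in IHHP.
      specialize (IHHP (updates f (map FV xs) (map FV ys)) g U).
      rewrite psub_open_updates in IHHP; auto; rewrite ?length_map; auto.
      2:{ intros u0 Hu0. apply in_map_iff in Hu0 as (x & <- & Hx). apply H2; auto. }
      2:{ intros X; apply HU. }
      rewrite !env_sub_app, env_sub_combine, map_updates, map_map, length_map in IHHP;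
        rewrite ?length_map; auto.
      rewrite (@env_sub_ext _ f U U G), (@env_sub_ext _ f U U D) in IHHP; auto.
      * apply IHHP; auto using id_renaming_updates.
      * intros v Hv; apply updates_notin. intros Hi.
        apply in_map_iff in Hi as (x & <- & Hx). apply Hk in Hv. apply H2 in Hx; tauto.
      * intros v Hv; apply updates_notin. intros Hi.
        apply in_map_iff in Hi as (x & <- & Hx). apply H2 in Hx; tauto.
  - rewrite !env_sub_app, env_sub_combine. destruct (decr_KId H) as [Hk HD].
    apply typ_out with (env_sub f U D); auto; [rewrite length_map; auto|].
    rewrite cat_app, <- env_sub_app; auto.
  - rewrite env_sub_app. apply typ_par; auto.
  - simpl; apply typ_if; auto using env_sub_keys.
  - destruct (fresh_nat (fpvars (psub f (pv_up g) P) ++ keys_nats (env_sub f U G))) as [Y HY].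
    rewrite in_app_iff in HY.
    apply typ_rec with Y; [apply env_sub_unr; auto|tauto|apply notin_keys_nats; simpl; tauto|].
    (* The derivation's process variable [X] is redirected to the fresh [Y]. The body of the
       substituted recursion opened with [Y] is then the [g']-instance of the body opened with
       [X]. *)
    pose (g' := fun Z => match Z with
      PFV Z' => if Nat.eqb Z' X then PVar (PFV Y) else g Z | _ => g Z end).
    specialize (IHHP f g' (fun Z => if Nat.eqb Z X then [(KPV Y, TProc)] else U Z)).
    rewrite cat_app. rewrite env_sub_app in IHHP.
    rewrite (@env_sub_ext _ f _ U G) in IHHP; auto.
    + simpl in IHHP. rewrite Nat.eqb_refl in IHHP.
      replace (pvsubst _ (psub f (pv_up g) P)) with (psub f g' (pvsubst (PVar (PFV X)) P)).
      * apply IHHP; auto. intros Z; unfold g'; destruct (Nat.eqb_spec Z X); auto.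
        repeat split; [constructor; simpl; auto|apply typ_var].
      * rewrite !pvsubst_psub, !psub_comp; auto.
        { apply psub_ext; auto. intros [[|i]|Z] HZ; simpl.
          - rewrite Nat.eqb_refl; auto.
          - rewrite !Hg; auto.
          - destruct (Nat.eqb_spec Z X); [subst; contradiction|].
            destruct (HU Z) as (Hlc & _).
            rewrite <- (@psub_lc (g (PFV Z)) (fun u => u) (pv_inst (PVar (PFV Y)))) at 1; auto.
            + f_equal. destruct (g (PFV Z)) as [| | | | |[j|W]| | | |]; auto.
              unfold lc in Hlc; simpl in Hlc; lia.
            + repeat split; auto.
            + intros W; auto. }
        { intros [[|i]|Z]; simpl; [eauto|rewrite Hg; simpl; eauto|].
          destruct (HU Z) as (Hlc & _). right; repeat split; auto.
          destruct (g (PFV Z)) as [| | | | |[j|W]| | | |]; auto. }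
        { intros [[|i]|Z]; simpl; eauto. }
    + intros Z HZ; destruct (Nat.eqb_spec Z X); auto. subst; contradiction.
  - simpl. rewrite app_nil_r. apply HU.
  - destruct (fresh_nat (fvars (psub (id_up 1 f) g P) ++ keys_nats (env_sub f U G))) as [y Hy].
    rewrite in_app_iff in Hy.
    apply typ_alloc with y Ts; [tauto|apply notin_keys_nats; simpl; tauto|].
    specialize (IHHP (updates f [FV x] [FV y]) g U).
    rewrite psub_open_updates in IHHP; auto; try (repeat constructor; simpl; tauto).
    2:{ intros u0 [<-|[]]; auto. }
    2:{ intros X; apply HU. }
    rewrite env_sub_app in IHHP; rewrite (@env_sub_ext _ f U U G) in IHHP; auto.
    + simpl in IHHP. destruct (ident_eq_dec (FV x) (FV x)); [|congruence].
      apply IHHP; auto. apply (@id_renaming_updates f [FV x] [FV y]); auto; repeat constructor.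
    + intros v Hv; apply updates_notin. intros [<-|[]]; contradiction.
  - rewrite env_sub_app. apply typ_free; auto.
  - apply typ_nil.
  - destruct (fresh_nat (fnames (psub (id_up 1 f) g P) ++ keys_nats (env_sub f U G))) as [y Hy].
    rewrite in_app_iff in Hy.
    apply typ_nu_top with y T; [tauto|apply notin_keys_nats; simpl; tauto|].
    specialize (IHHP (updates f [Nm c] [Nm y]) g U).
    rewrite psub_open_updates in IHHP; auto; try (repeat constructor; simpl; tauto).
    2:{ intros u0 [<-|[]]; auto. }
    2:{ intros X; apply HU. }
    rewrite env_sub_app in IHHP; rewrite (@env_sub_ext _ f U U G) in IHHP; auto.
    + simpl in IHHP. destruct (ident_eq_dec (Nm c) (Nm c)); [|congruence].
      apply IHHP; auto. apply (@id_renaming_updates f [Nm c] [Nm y]); auto; repeat constructor.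
    + intros v Hv; apply updates_notin. intros [<-|[]]; contradiction.
  - destruct (fresh_nat (fnames (psub (id_up 1 f) g P) ++ keys_nats (env_sub f U G))) as [y Hy].
    rewrite in_app_iff in Hy.
    apply typ_nu_bot with y; [tauto|apply notin_keys_nats; simpl; tauto|].
    specialize (IHHP (updates f [Nm c] [Nm y]) g U).
    rewrite psub_open_updates in IHHP; auto; try (repeat constructor; simpl; tauto).
    2:{ intros u0 [<-|[]]; auto. }
    2:{ intros X; apply HU. }
    rewrite (@env_sub_ext _ f U U G) in IHHP; auto.
    + apply IHHP; auto. apply (@id_renaming_updates f [Nm c] [Nm y]); auto; repeat constructor.
    + intros v Hv; apply updates_notin. intros [<-|[]]; contradiction.
  - exact (ref_step G k (step_split H)).
  - apply ref_drop_r.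
  - exact (ref_step G k (step_sub H)).
  - exact (ref_step G k (step_bullet0 Ts1 Ts2)).
  - apply ref_perm; symmetry; auto.
Qed.

Definition pv_env (X : nat) : env := [(KPV X, TProc)].

(** Only a refinement and not an equality: [env_sub] drops channel-typed assumptions on process
    variables. *)
Lemma ref_env_sub_id G : ref G (env_sub (fun u => u) pv_env G).
Proof.
  induction G as [|[[u|X] [Ts a|]] G IH]; try apply ref_refl;
    try exact (ref_app_l [_] IH).
  simpl. change ((KPV X, TCh Ts a) :: G) with ([(KPV X, TCh Ts a)] ++ G).
  eapply ref_trans; [apply ref_drop_l|auto].
Qed.

(** [vs] may be neither fresh nor distinct, so the same fact renames binders and instantiates an
    input with the received names. *)
Lemma typ_reopen G us vs Ts P :
  NoDup us -> length us = length vs -> Forall (id_lc 0) us -> Forall (id_lc 0) vs ->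
  (forall u, In u us -> ~ id_free u P) -> (forall u, In u us -> ~ In (KId u) (keys G)) ->
  typ (G ++ combine (map KId us) Ts) (open us P) ->
  typ (G ++ combine (map KId vs) Ts) (open vs P).
Proof.
  intros Hn Hl Hus Hvs HfP HfG HP.
  apply (@typ_psub _ _ (updates (fun u => u) us vs) PVar pv_env) in HP; auto.
  - rewrite psub_open_updates in HP; auto using id_renaming_id.
    2:{ intros; exact I. }
    rewrite (@psub_ext _ _ (fun u => u) _ PVar), psub_id in HP; auto using id_up_id.
    rewrite env_sub_app, env_sub_combine, map_updates in HP; auto.
    rewrite (@env_sub_ext _ (fun u => u) _ pv_env) in HP; auto.
    + eapply typ_ref; [|exact HP]. apply ref_app; [apply ref_env_sub_id|apply ref_refl].
    + intros u Hu; apply updates_notin. intros Hi; eapply HfG; eauto.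
  - apply id_renaming_updates; auto using id_renaming_id.
  - intros X; repeat split; [constructor; simpl; auto|apply typ_var].
Qed.

(** * Inversion under binders and strengthening *)

Lemma typ_par_inv G P Q :
  typ G (PPar P Q) -> exists G1 G2, ref G (G1 ++ G2) /\ typ G1 P /\ typ G2 Q.
Proof.
  intros H; apply typ_inv in H as (H & HG & G1 & G2 & -> & HP & HQ); eauto.
Qed.

Lemma typ_nu_inv G s c P :
  typ G (PNu s P) -> exists T, typ (G ++ nu_env s c T) (open [Nm c] P).
Proof.
  intros H; apply typ_inv in H as (H & HG & d & T & Hd1 & Hd2 & HP); exists T.
  apply typ_ref with (H ++ nu_env s c T); [apply ref_app; auto using ref_refl|].
  assert (E : forall e, nu_env s e T = combine (map KId [Nm e]) (match s with Top => [T] | Bot => [] end))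
    by (destruct s; auto).
  rewrite E in HP |- *.
  eapply typ_reopen; [..|exact HP]; auto; try (repeat constructor; simpl; tauto);
    intros u [<-|[]]; auto.
Qed.

Lemma typ_alloc_inv G c P :
  typ G (PAlloc P) -> exists Ts, typ (G ++ [(KId (Nm c), TCh Ts (Uniq 0))]) (open [Nm c] P).
Proof.
  intros H; apply typ_inv in H as (H & HG & x & Ts & Hx1 & Hx2 & HP); exists Ts.
  apply typ_ref with (H ++ [(KId (Nm c), TCh Ts (Uniq 0))]); [apply ref_app; auto using ref_refl|].
  apply (@typ_reopen H [FV x] [Nm c] [TCh Ts (Uniq 0)] P); auto; try (repeat constructor; simpl; tauto);
    intros u [<-|[]]; auto.
Qed.

Lemma fnames_popen c us P k : In c (fnames (popen k us P)) -> In c (fnames P) \/ In (Nm c) us.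
Proof.
  assert (Hid : forall k u, In c (id_names (id_open k us u)) -> In c (id_names u) \/ In (Nm c) us).
  { intros k0 [i|x|d]; simpl; auto. destruct (Nat.leb k0 i); simpl; [|tauto].
    destruct (Nat.lt_ge_cases (i - k0) (length us)) as [Hi|Hi].
    - assert (Hin := nth_In _ (BV i) Hi). destruct (nth (i - k0) us (BV i)); simpl; try tauto.
      intros [<-|[]]; auto.
    - rewrite nth_overflow by auto; simpl; tauto. }
  revert k; induction P as [u vs P IH|u n P IH| |u v P IHP Q IHQ|P IH|X|P IHP Q IHQ|s P IH|P IH|u P IH];
    intros k; simpl; rewrite ?cat_app, ?in_app_iff; eauto.
  - intros [H|[H|H]].
    + apply Hid in H; tauto.
    + apply in_flat_map in H as (w & Hw & H). apply in_map_iff in Hw as (v & <- & Hv).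
      apply Hid in H as [H|H]; auto. left; right; left; apply in_flat_map; eauto.
    + apply IH in H; tauto.
  - intros [H|H]; [apply Hid in H|apply IH in H]; tauto.
  - intros [H|[H|[H|H]]]; [apply Hid in H|apply Hid in H|apply IHP in H|apply IHQ in H]; tauto.
  - intros [H|H]; [apply IHP in H|apply IHQ in H]; tauto.
  - intros [H|H]; [apply Hid in H|apply IH in H]; tauto.
Qed.

Lemma fnames_pvopen X P k : fnames (pvopen k (PVar (PFV X)) P) = fnames P.
Proof.
  revert k; induction P as [u vs P IH|u n P IH| |u v P IHP Q IHQ|P IH|Y|P IHP Q IHQ|s P IH|P IH|u P IH];
    intros k; simpl; rewrite ?IH, ?IHP, ?IHQ; auto.
  destruct Y as [i|Y]; simpl; auto; destruct (Nat.eqb i k); auto.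
Qed.

Lemma off_key_app k G H : off_key k (G ++ H) = off_key k G ++ off_key k H.
Proof. apply filter_app. Qed.

Lemma at_key_app k G H : at_key k (G ++ H) = at_key k G ++ at_key k H.
Proof. apply filter_app. Qed.

(** A syntax-directed rule consumes or looks up assumptions only on identifiers occurring in the
    process; those on an absent name can only have been discarded or passed on. This serves scope
    extrusion, where the share of the outer process may mention the restricted name. *)
Lemma typ_strengthen G P c :
  typ G P -> ~ In c (fnames P) -> typ (off_key (KId (Nm c)) G) P.
Proof.
  intros HP; induction HP; intros Hc; simpl in Hc; rewrite ?cat_app, ?in_app_iff in *;
    try (match goal with IH : _ -> typ (off_key _ ?H) ?P
         |- typ (off_key ?k ?G) ?P => apply typ_ref with (off_key k H); [apply ref_off_key|auto] end).
  - assert (Hu : Nm c <> u) by (intros <-; simpl in *; tauto).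
    rewrite off_key_app, (@off_key_notin _ [_]) by (simpl; intuition congruence).
    eapply typ_inp; eauto.
    + intros x Hx; specialize (H2 x Hx). rewrite in_keys_off_key; tauto.
    + rewrite !off_key_app, (@off_key_notin _ D), (@off_key_notin _ (combine _ _)) in IHHP.
      * apply IHHP. unfold open; intros Hi; apply fnames_popen in Hi as [Hi|Hi]; [tauto|].
        apply in_map_iff in Hi as (x & E & _); congruence.
      * intros Hi; apply in_map_iff in Hi as ([k T] & E & Hi); simpl in E; subst.
        apply in_combine_l in Hi; apply in_map_iff in Hi as (x & E & _); congruence.
      * intros Hi; apply (proj1 (decr_KId H)) in Hi; auto.
  - assert (Hu : Nm c <> u) by (intros <-; simpl in *; tauto).
    rewrite off_key_app, (@off_key_notin _ (_ ++ _)).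
    + eapply typ_out; eauto.
      rewrite !off_key_app, (@off_key_notin _ D) in IHHP; [apply IHHP; tauto|].
      intros Hi; apply (proj1 (decr_KId H)) in Hi; auto.
    + intros [Hi|Hi]; [simpl in Hi; congruence|].
      apply in_map_iff in Hi as ([k T] & E & Hi); simpl in E; subst.
      apply in_combine_l in Hi; apply in_map_iff in Hi as (v & E & Hv). inversion E; subst.
      apply Hc; right; left; apply in_flat_map; exists (Nm c); simpl; auto.
  - rewrite off_key_app; apply typ_par; tauto.
  - apply typ_if; try tauto; rewrite in_keys_off_key; split; auto;
      intros E; inversion E; subst; simpl in *; tauto.
  - apply typ_rec with X; auto.
    + unfold unr in *; rewrite Forall_forall in *. intros a Ha; apply filter_In in Ha; apply H; tauto.
    + rewrite in_keys_off_key; tauto.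
    + rewrite off_key_app, (@off_key_notin _ [_]) in IHHP by (simpl; intuition congruence).
      apply IHHP. unfold pvsubst; rewrite fnames_pvopen; auto.
  - rewrite off_key_notin by (simpl; intuition congruence). apply typ_var.
  - apply typ_alloc with x Ts; auto; [rewrite in_keys_off_key; tauto|].
    rewrite off_key_app, (@off_key_notin _ [_]) in IHHP by (simpl; intuition congruence).
    apply IHHP. unfold open; intros Hi; apply fnames_popen in Hi as [Hi|[Hi|[]]]; [tauto|congruence].
  - assert (Hu : Nm c <> u) by (intros <-; simpl in *; tauto).
    rewrite off_key_app, (@off_key_notin _ [_]) by (simpl; intuition congruence).
    apply typ_free; tauto.
  - apply typ_nil.
  (* The derivation may have picked [c] itself for the bound name. Then [G] has no assumption on [c]
     and nothing is to be removed; the induction hypothesis would not apply, since [c] may occur in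
     the opened body. *)
  - destruct (Nat.eq_dec c c0) as [<-|Hn].
    + rewrite off_key_notin; eauto using typ_nu_top.
    + apply typ_nu_top with c0 T; auto; [rewrite in_keys_off_key; tauto|].
      rewrite off_key_app, (@off_key_notin _ [_]) in IHHP by (simpl; intuition congruence).
      apply IHHP. unfold open; intros Hi; apply fnames_popen in Hi as [Hi|[Hi|[]]]; [tauto|congruence].
  - destruct (Nat.eq_dec c c0) as [<-|Hn].
    + rewrite off_key_notin; eauto using typ_nu_bot.
    + apply typ_nu_bot with c0; auto; [rewrite in_keys_off_key; tauto|].
      apply IHHP. unfold open; intros Hi; apply fnames_popen in Hi as [Hi|[Hi|[]]]; [tauto|congruence].
  - exact (ref_step G k (step_split H)).
  - apply ref_drop_r.
  - exact (ref_step G k (step_sub H)).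
  - exact (ref_step G k (step_bullet0 Ts1 Ts2)).
  - apply ref_perm; symmetry; auto.
Qed.

(** * Structural equivalence preserves typing *)

Lemma free_bvmap h P k :
  fvars (bvmap h k P) = fvars P /\ fnames (bvmap h k P) = fnames P /\ fpvars (bvmap h k P) = fpvars P.
Proof.
  assert (Hid : forall k u, id_vars (id_bvmap h k u) = id_vars u /\ id_names (id_bvmap h k u) = id_names u).
  { intros k0 [i|x|d]; simpl; auto. destruct (Nat.ltb i k0); auto. }
  assert (Hid1 := fun k u => proj1 (Hid k u)). assert (Hid2 := fun k u => proj2 (Hid k u)).
  revert k; induction P as [u vs P IH|u n P IH| |u v P IHP Q IHQ|P IH|X|P IHP Q IHQ|s P IH|P IH|u P IH];
    intros k; simpl; rewrite ?Hid1, ?Hid2; auto;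
    try (destruct (IH k) as (-> & -> & ->); auto; fail);
    try (destruct (IHP k) as (-> & -> & ->), (IHQ k) as (-> & -> & ->); auto; fail).
  - destruct (IH k) as (-> & -> & ->). rewrite !flat_map_concat_map, !map_map.
    rewrite (map_ext _ _ (Hid1 k)), (map_ext _ _ (Hid2 k)); auto.
  - destruct (IH (k + n)) as (-> & -> & ->); auto.
Qed.

Lemma sc_free_ids P Q : sc P Q ->
  (forall x, In x (fvars P) <-> In x (fvars Q)) /\
  (forall c, In c (fnames P) <-> In c (fnames Q)) /\
  (forall X, In X (fpvars P) <-> In X (fpvars Q)).
Proof.
  assert (Hs : forall P, fvars (shift P) = fvars P /\
      fnames (shift P) = fnames P /\ fpvars (shift P) = fpvars P)
    by (intros; apply free_bvmap).
  assert (Hw : forall P, fvars (swap01 P) = fvars P /\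
      fnames (swap01 P) = fnames P /\ fpvars (swap01 P) = fpvars P)
    by (intros; apply free_bvmap).
  induction 1; simpl; rewrite ?cat_app;
    try (destruct (Hs Q) as (-> & -> & ->)); try (destruct (Hw P) as (-> & -> & ->));
    repeat split; intros; rewrite ?in_app_iff in *; simpl in *; firstorder.
Qed.

(** Such substitutions commute with [shift] and [swap01]: they insert no identifier that would have
    to be lifted. *)
Definition pv_renaming (g : pvar -> proc) : Prop := forall X, exists Y, g X = PVar Y.

Lemma pv_renaming_up g : pv_renaming g -> pv_renaming (pv_up g).
Proof.
  intros H [[|i]|Y]; simpl; eauto;
    [destruct (H (PBV i)) as [[]->]|destruct (H (PFV Y)) as [[]->]]; simpl; eauto.
Qed.

Lemma pv_renaming_comp f g g' :
  pv_renaming g -> pv_renaming g' -> pv_renaming (fun X => psub f g (g' X)).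
Proof. intros H H' X; destruct (H' X) as [Y ->]; apply H. Qed.

Lemma pv_renaming_PVar : pv_renaming PVar.
Proof. intros X; eauto. Qed.

Lemma pv_renaming_inst X : pv_renaming (pv_inst (PVar X)).
Proof. intros [[|i]|Y]; simpl; eauto. Qed.

Lemma psub_bvmap f f' g h P :
  pv_renaming g -> (forall u, f (id_reindex h u) = id_reindex h (f' u)) ->
  psub f g (bvmap h 0 P) = bvmap h 0 (psub f' g P).
Proof.
  intros Hg Hf. rewrite !bvmap_psub, !psub_comp by eauto. apply psub_ext.
  - intros; rewrite !id_up0; auto.
  - intros X _; destruct (Hg X) as [Y HY]; simpl; rewrite HY; auto.
Qed.

Lemma psub_shift f g P :
  pv_renaming g -> psub (id_up 1 f) g (shift P) = shift (psub f g P).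
Proof.
  intros Hg; apply psub_bvmap; auto. intros [i|x|c]; simpl.
  - rewrite subn1; simpl. destruct (f (BV i)); auto.
  - destruct (f (FV x)); auto.
  - destruct (f (Nm c)); auto.
Qed.

Lemma psub_swap01 f g P :
  pv_renaming g -> psub (id_up 1 (id_up 1 f)) g (swap01 P) = swap01 (psub (id_up 1 (id_up 1 f)) g P).
Proof.
  intros Hg; apply psub_bvmap; auto. intros u.
  rewrite !id_up_up. destruct u as [[|[|i]]|x|c]; simpl; auto;
    [destruct (f _)|destruct (f (FV x))|destruct (f (Nm c))]; auto.
Qed.

Lemma sc_psub P Q f g : pv_renaming g -> sc P Q -> sc (psub f g P) (psub f g Q).
Proof.
  intros Hg HPQ; revert f g Hg; induction HPQ; intros f g Hg; simpl;
    rewrite ?psub_shift, ?psub_swap01 by auto;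
    try (econstructor; eauto using pv_renaming_up; fail).
Qed.

Lemma typ_PNil G : typ G PNil.
Proof. eapply typ_ref; [apply ref_nil|apply typ_nil]. Qed.

Lemma typ_par_intro G G1 G2 P Q : ref G (G1 ++ G2) -> typ G1 P -> typ G2 Q -> typ G (PPar P Q).
Proof. intros HG HP HQ; eapply typ_ref; [exact HG|]. apply typ_par; auto. Qed.

Lemma typ_par_comm G P Q : typ G (PPar P Q) -> typ G (PPar Q P).
Proof.
  intros H; apply typ_par_inv in H as (G1 & G2 & HG & HP & HQ).
  apply typ_par_intro with G2 G1; auto. eapply ref_trans; [exact HG|apply ref_app_comm].
Qed.

Lemma typ_par_nil G P : typ G (PPar P PNil) <-> typ G P.
Proof.
  split; intros H.
  - apply typ_par_inv in H as (G1 & G2 & HG & HP & HQ).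
    eapply typ_ref; [|exact HP]. eapply ref_trans; [exact HG|apply ref_drop_r].
  - apply typ_par_intro with G []; auto using typ_nil. rewrite app_nil_r; apply ref_refl.
Qed.

Lemma typ_par_assoc G P Q R : typ G (PPar (PPar P Q) R) <-> typ G (PPar P (PPar Q R)).
Proof.
  split; intros H; apply typ_par_inv in H as (G1 & G2 & HG & H1 & H2).
  - apply typ_par_inv in H1 as (G3 & G4 & HG1 & H3 & H4).
    apply typ_par_intro with G3 (G4 ++ G2); auto.
    + rewrite app_assoc. eapply ref_trans; [exact HG|]. apply ref_app; auto using ref_refl.
    + apply typ_par; auto.
  - apply typ_par_inv in H2 as (G3 & G4 & HG1 & H3 & H4).
    apply typ_par_intro with (G1 ++ G3) G4; auto.
    + rewrite <- app_assoc. eapply ref_trans; [exact HG|]. apply ref_app; auto using ref_refl.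
    + apply typ_par; auto.
Qed.

Lemma open_open c d P : open [Nm d] (popen 1 [Nm c] P) = open [Nm d; Nm c] P.
Proof.
  rewrite (@popen_psub [Nm c]), !open_psub by (repeat constructor).
  rewrite psub_comp by eauto. apply psub_ext; auto.
  intros [[|[|i]]|x|e] _; simpl; auto. destruct i; auto.
Qed.

Lemma open_PNu c s P : open [Nm c] (PNu s P) = PNu s (popen 1 [Nm c] P).
Proof. reflexivity. Qed.

Lemma swap01_open c d P : open [Nm d; Nm c] (swap01 P) = open [Nm c; Nm d] P.
Proof.
  unfold swap01. rewrite bvmap_psub, !open_psub by (repeat constructor).
  rewrite psub_comp by eauto. apply psub_ext; auto.
  intros [[|[|i]]|x|e] _; simpl; auto.
Qed.

Lemma swap01_involutive P : swap01 (swap01 P) = P.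
Proof.
  unfold swap01. rewrite !bvmap_psub, psub_comp by eauto.
  rewrite <- (psub_id P) at 2. apply psub_ext; auto.
  intros [[|[|i]]|x|e] _; simpl; auto.
Qed.

Lemma open_shift c P : lc P -> open [Nm c] (shift P) = P.
Proof.
  intros HP. unfold shift. rewrite bvmap_psub, open_psub by (repeat constructor).
  rewrite psub_comp by eauto. apply psub_lc; [auto|split; auto|intros X; auto].
Qed.

Lemma lc_at_bvmap h P j m m' kp :
  (forall i, h i < m' <-> i < m) ->
  lc_at (j + m') kp (bvmap h j P) <-> lc_at (j + m) kp P.
Proof.
  intros Hh.
  assert (Hid : forall j u, id_lc (j + m') (id_bvmap h j u) <-> id_lc (j + m) u).
  { intros j0 [i|x|c]; simpl; try tauto. specialize (Hh (i - j0)).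
    destruct (Nat.ltb_spec i j0); simpl; [split; intros; lia|].
    split; intros H1; [assert (h (i - j0) < m') by lia|assert (i - j0 < m) by lia]; apply Hh in H0; lia. }
  revert j kp; induction P as [u vs P IH|u n P IH| |u v P IHP Q IHQ|P IH|X|P IHP Q IHQ|s P IH|P IH|u P IH];
    intros j kp; simpl; rewrite ?Hid, ?IH, ?IHP, ?IHQ; try tauto.
  - rewrite Forall_map. rewrite !Forall_forall. setoid_rewrite Hid; tauto.
  - replace (j + m' + n) with (j + n + m') by lia. replace (j + m + n) with (j + n + m) by lia.
    rewrite IH; tauto.
  - rewrite <- !addSn; apply IH.
  - rewrite <- !addSn; apply IH.
Qed.

Lemma lc_at_shift P k kp : lc_at (S k) kp (shift P) <-> lc_at k kp P.
Proof. apply (@lc_at_bvmap S P 0 k (S k)). intros i; lia. Qed.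

Lemma lc_at_swap01 P k kp : lc_at (S (S k)) kp (swap01 P) <-> lc_at (S (S k)) kp P.
Proof.
  apply (@lc_at_bvmap _ P 0 (S (S k)) (S (S k))). intros [|[|i]]; lia.
Qed.

Lemma sc_lc_at P Q : sc P Q -> forall k kp, lc_at k kp P <-> lc_at k kp Q.
Proof.
  induction 1; intros k kp; simpl; rewrite ?lc_at_shift, ?lc_at_swap01; try tauto;
    try (rewrite IHsc1, IHsc2; tauto); rewrite ?IHsc, ?IHsc1, ?IHsc2; tauto.
Qed.

Lemma lc_at_popen us P k kp n :
  Forall (id_lc 0) us -> length us = n -> lc_at (k + n) kp P -> lc_at k kp (popen k us P).
Proof.
  intros Hus Hn.
  assert (Hid : forall k u, id_lc (k + n) u -> id_lc k (id_open k us u)).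
  { intros j [i|x|c]; simpl; auto. intros Hi. destruct (Nat.leb_spec j i); simpl; [|lia].
    rewrite Forall_forall in Hus.
    assert (Hl : (i - j < length us)%coq_nat) by lia.
    specialize (Hus _ (nth_In _ (BV i) Hl)). destruct (nth (i - j) us (BV i)); simpl in *; auto; lia. }
  revert k kp; induction P as [u vs P IH|u m P IH| |u v P IHP Q IHQ|P IH|X|P IHP Q IHQ|s P IH|P IH|u P IH];
    intros k kp; simpl; auto; try (intuition auto; fail).
  - rewrite Forall_map, !Forall_forall. intuition auto.
  - replace (k + n + m) with (k + m + n) by lia. intuition auto.
Qed.

Lemma lc_open us P n : Forall (id_lc 0) us -> length us = n -> lc_at n 0 P -> lc (open us P).
Proof. intros Hus Hn HP; eapply lc_at_popen; eauto. Qed.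

Lemma lc_at_pvopen X P k kp : lc_at k (S kp) P -> lc_at k kp (pvopen kp (PVar (PFV X)) P).
Proof.
  revert k kp; induction P as [u vs P IH|u m P IH| |u v P IHP Q IHQ|P IH|Y|P IHP Q IHQ|s P IH|P IH|u P IH];
    intros k kp; simpl; auto; try (intuition auto; fail).
  destruct Y; simpl; auto. destruct (Nat.eqb_spec i kp); simpl; auto. lia.
Qed.

(** Local closure of [Q] makes opening cancel [shift]. One name [c], fresh for both processes and
    for [G], serves both directions. *)
Lemma typ_extr G s P Q : lc Q -> typ G (PPar (PNu s P) Q) <-> typ G (PNu s (PPar P (shift Q))).
Proof.
  intros HQl. destruct (fresh_nat (fnames P ++ fnames Q ++ keys_nats G)) as [c Hc].
  rewrite !in_app_iff in Hc.
  assert (HcG : ~ In (KId (Nm c)) (keys G)) by (apply notin_keys_nats; tauto).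
  assert (Es : fnames (shift Q) = fnames Q) by apply free_bvmap.
  split; intros H.
  - apply typ_par_inv in H as (G1 & G2 & HG & HP & HQ).
    apply (typ_nu_inv c) in HP as [T HP].
    eapply typ_ref; [exact HG|].
    apply typ_nu with c T.
    + simpl. rewrite Es, cat_app, in_app_iff; tauto.
    + intros Hi; apply HcG; eapply ref_keys; eauto.
    + change (open [Nm c] (PPar P (shift Q))) with (PPar (open [Nm c] P) (open [Nm c] (shift Q))).
      rewrite open_shift by auto.
      eapply typ_par_intro; eauto. rewrite <- !app_assoc. apply ref_app_l, ref_app_comm.
  - apply (typ_nu_inv c) in H as [T H].
    change (open [Nm c] (PPar P (shift Q))) with (PPar (open [Nm c] P) (open [Nm c] (shift Q))) in H.
    rewrite open_shift in H by auto.
    apply typ_par_inv in H as (G1 & G2 & HG & HP & HQ).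
    set (k := KId (Nm c)) in *.
    (* The split may have handed part of the assumption on [c] to [Q]; that part is discarded, as
       [c] does not occur in [Q]. *)
    apply (@typ_strengthen _ _ c) in HQ; [|tauto].
    assert (Hk1 : at_key k (nu_env s c T) = nu_env s c T).
    { destruct s; auto. simpl. unfold keyb. destruct (key_eq_dec _ _); auto. contradiction. }
    assert (Hk2 : off_key k (nu_env s c T) = []).
    { destruct s; auto. simpl. unfold keyb. destruct (key_eq_dec _ _); auto. contradiction. }
    assert (Hoff := ref_off_key k HG). assert (Hat := ref_at_key k HG).
    rewrite !off_key_app, Hk2, app_nil_r, (off_key_notin HcG) in Hoff.
    rewrite !at_key_app, Hk1, (at_key_notin HcG) in Hat.
    apply typ_par_intro with (off_key k G1) (off_key k G2); auto.
    apply typ_nu with c T; [tauto|rewrite in_keys_off_key; tauto|].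
    eapply typ_ref; [|exact HP].
    (* What [P] holds on [c] refines the assumption introduced by the restriction, which is
       therefore enough to type it. *)
    eapply ref_trans; [|apply ref_perm, Permutation_sym, (off_at_key_perm k)].
    apply ref_app_l. eapply ref_trans; [exact Hat|apply ref_drop_r].
Qed.

(** One direction suffices, because [swap01] is an involution. *)
Lemma typ_nu_swap_r G s s' P :
  typ G (PNu s (PNu s' P)) -> typ G (PNu s' (PNu s (swap01 P))).
Proof.
  destruct (fresh_nats (fnames P ++ keys_nats G) 2) as (cs & Hl & Hn & Hfr).
  destruct cs as [|c [|d []]]; try discriminate.
  assert (Hcd : d <> c) by (inversion Hn; subst; simpl in *; intuition congruence).
  assert (Hc := Hfr c (or_introl Logic.eq_refl)). assert (Hd := Hfr d (or_intror (or_introl Logic.eq_refl))).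
  rewrite in_app_iff in Hc, Hd.
  assert (HcG : ~ In (KId (Nm c)) (keys G)) by (apply notin_keys_nats; tauto).
  assert (HdG : ~ In (KId (Nm d)) (keys G)) by (apply notin_keys_nats; tauto).
  assert (Es : fnames (swap01 P) = fnames P) by apply free_bvmap.
  intros H. apply (typ_nu_inv c) in H as [T H]. rewrite open_PNu in H.
  apply (typ_nu_inv d) in H as [T' H]. rewrite open_open in H.
  apply typ_nu with d T'; [simpl; rewrite Es; tauto|auto|].
  rewrite open_PNu. apply typ_nu with c T.
  - intros Hi; apply fnames_popen in Hi as [Hi|[Hi|[]]]; [rewrite Es in Hi; tauto|congruence].
  - rewrite keys_app, in_app_iff. intros [Hi|Hi]; auto.
    destruct s'; simpl in Hi; intuition congruence.
  - rewrite open_open, swap01_open.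
    eapply typ_ref; [|exact H]. rewrite <- !app_assoc. apply ref_app_l, ref_app_comm.
Qed.

Lemma typ_nu_nil G s : typ G (PNu s PNil).
Proof.
  destruct (fresh_nat (keys_nats G)) as [c Hc].
  apply typ_nu with c TProc; auto; [apply notin_keys_nats; auto|apply typ_PNil].
Qed.

(** The bodies are compared under every locally closed opening, because the identifiers chosen by
    the derivation are not known beforehand. The inclusion of free variables carries over their
    freshness. *)
Lemma typ_inp_mono G u n P Q :
  (forall x, In x (fvars Q) -> In x (fvars P)) ->
  (forall H us, Forall (id_lc 0) us -> length us = n -> typ H (open us P) -> typ H (open us Q)) ->
  typ G (PInp u n P) -> typ G (PInp u n Q).
Proof.
  intros Hv HPQ H; apply typ_inv in H as (H & HG & G0 & Ts & a & D & xs & -> & -> & HD & Hl & Hn & Hfr & HP).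
  eapply typ_ref; [exact HG|]. eapply typ_inp; eauto.
  - intros x Hx; specialize (Hfr x Hx); intuition auto.
  - rewrite <- (map_map FV KId). apply HPQ; auto using lc_FV. rewrite length_map; auto.
Qed.

Lemma typ_rec_mono G P Q :
  (forall X, In X (fpvars Q) -> In X (fpvars P)) ->
  (forall H X, typ H (pvsubst (PVar (PFV X)) P) -> typ H (pvsubst (PVar (PFV X)) Q)) ->
  typ G (PRec P) -> typ G (PRec Q).
Proof.
  intros Hv HPQ H; apply typ_inv in H as (H & HG & X & Hu & HX1 & HX2 & HP).
  eapply typ_ref; [exact HG|]. apply typ_rec with X; auto.
Qed.

Lemma typ_nu_mono G s P Q :
  (forall c, In c (fnames Q) -> In c (fnames P)) ->
  (forall H us, Forall (id_lc 0) us -> length us = 1 -> typ H (open us P) -> typ H (open us Q)) ->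
  typ G (PNu s P) -> typ G (PNu s Q).
Proof.
  intros Hv HPQ H; apply typ_inv in H as (H & HG & c & T & Hc1 & Hc2 & HP).
  eapply typ_ref; [exact HG|]. apply typ_nu with c T; auto.
  apply HPQ; auto. repeat constructor.
Qed.

Lemma typ_alloc_mono G P Q :
  (forall x, In x (fvars Q) -> In x (fvars P)) ->
  (forall H us, Forall (id_lc 0) us -> length us = 1 -> typ H (open us P) -> typ H (open us Q)) ->
  typ G (PAlloc P) -> typ G (PAlloc Q).
Proof.
  intros Hv HPQ H; apply typ_inv in H as (H & HG & x & T & Hx1 & Hx2 & HP).
  eapply typ_ref; [exact HG|]. apply typ_alloc with x T; auto.
  apply HPQ; auto. repeat constructor.
Qed.

Lemma typ_out_mono G u vs P Q :
  (forall H, typ H P -> typ H Q) -> typ G (POut u vs P) -> typ G (POut u vs Q).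
Proof.
  intros HPQ H; apply typ_inv in H as (H & HG & G0 & Ts & a & D & -> & HD & Hl & HP).
  eapply typ_ref; [exact HG|]. eapply typ_out; eauto.
Qed.

Lemma typ_free_mono G u P Q :
  (forall H, typ H P -> typ H Q) -> typ G (PFree u P) -> typ G (PFree u Q).
Proof.
  intros HPQ H; apply typ_inv in H as (H & HG & G0 & Ts & -> & HP).
  eapply typ_ref; [exact HG|]. eapply typ_free; eauto.
Qed.

Lemma typ_if_mono G u v P P' Q Q' :
  (forall H, typ H P -> typ H P') -> (forall H, typ H Q -> typ H Q') ->
  typ G (PIf u v P Q) -> typ G (PIf u v P' Q').
Proof.
  intros HP HQ H; apply typ_inv in H as (H & HG & Hu & Hv & H1 & H2).
  eapply typ_ref; [exact HG|]. eapply typ_if; eauto.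
Qed.

Lemma typ_par_mono G P P' Q Q' :
  (forall H, typ H P -> typ H P') -> (forall H, typ H Q -> typ H Q') ->
  typ G (PPar P Q) -> typ G (PPar P' Q').
Proof.
  intros HP HQ H; apply typ_par_inv in H as (G1 & G2 & HG & H1 & H2).
  eapply typ_par_intro; eauto.
Qed.

(** The resulting pair does not depend on [P], so both sides of an equivalence become instances of
    the same substitution. *)
Lemma open_psub_comp us f g :
  Forall (id_lc 0) us -> pv_renaming g ->
  exists f' g', pv_renaming g' /\ forall P, open us (psub f g P) = psub f' g' P.
Proof.
  intros Hus Hg; do 2 eexists; split; cycle 1.
  - intros P; rewrite open_psub, psub_comp; [reflexivity|eauto|auto].
  - apply pv_renaming_comp; auto using pv_renaming_PVar.
Qed.

Lemma pvsubst_psub_comp X f g :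
  pv_renaming g ->
  exists f' g', pv_renaming g' /\ forall P, pvsubst (PVar (PFV X)) (psub f g P) = psub f' g' P.
Proof.
  intros Hg; do 2 eexists; split; cycle 1.
  - intros P; rewrite pvsubst_psub, psub_comp; [reflexivity|eauto|auto].
  - apply pv_renaming_comp; auto using pv_renaming_inst.
Qed.

(** The congruence cases need the claim for opened bodies, which are not subterms but are again
    substitution instances of them. Local closure is asked of the instance because extrusion needs
    it; it is itself invariant, which carries it across symmetry and transitivity. *)
Lemma sc_typ_psub P Q : sc P Q -> forall f g, pv_renaming g -> lc (psub f g P) ->
  forall H, typ H (psub f g P) <-> typ H (psub f g Q).
Proof.
  assert (Hopen : forall P Q f g n H us,
    (forall f g, pv_renaming g -> lc (psub f g P) -> forall H, typ H (psub f g P) <-> typ H (psub f g Q)) ->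
    pv_renaming g -> lc_at n 0 (psub f g P) -> Forall (id_lc 0) us -> length us = n ->
    typ H (open us (psub f g P)) <-> typ H (open us (psub f g Q))).
  { intros P0 Q0 f g n H us IH Hg Hl Hus Hn.
    destruct (open_psub_comp f Hus Hg) as (f' & g' & Hg' & E).
    rewrite !E. apply IH; auto. rewrite <- E. eapply lc_open; eauto. }
  intros HPQ.
  induction HPQ as [P|P Q|P Q R|s|s s' P|s P Q|P|P Q HPQ IH|P Q R HPQ IH1 HQR IH2|u vs P Q HPQ IH
    |u n P Q HPQ IH|u v P P' Q Q' HP IH1 HQ IH2|P Q HPQ IH|P P' Q Q' HP IH1 HQ IH2|s P Q HPQ IH
    |P Q HPQ IH|u P Q HPQ IH];
    intros f g Hg Hl H; cbn [psub] in *.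
  - apply typ_par_nil.
  - split; apply typ_par_comm.
  - apply typ_par_assoc.
  - split; intros _; [apply typ_PNil|apply typ_nu_nil].
  - rewrite psub_swap01 by auto. split; intros HT; apply typ_nu_swap_r in HT; auto.
    rewrite swap01_involutive in HT; auto.
  - rewrite psub_shift by auto. apply typ_extr. apply Hl.
  - tauto.
  - symmetry; apply IH; auto. apply (sc_lc_at (sc_psub f Hg HPQ)); auto.
  - rewrite IH1 by auto. apply IH2; auto. apply (sc_lc_at (sc_psub f Hg HPQ)); auto.
  - destruct Hl as (_ & _ & Hl). split; apply typ_out_mono; intros; apply (IH f g Hg Hl); auto.
  - destruct Hl as (_ & Hl).
    assert (Hs := sc_free_ids (sc_psub (id_up n f) Hg HPQ)).
    split; apply typ_inp_mono; try (intros; apply Hs; auto; fail);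
      intros K us Hus Hn; apply (Hopen P Q _ _ n); auto.
  - destruct Hl as (_ & _ & Hl1 & Hl2).
    split; apply typ_if_mono; intros; try (apply (IH1 f g Hg Hl1); auto; fail); apply (IH2 f g Hg Hl2); auto.
  - assert (Hs := sc_free_ids (sc_psub f (pv_renaming_up Hg) HPQ)).
    split; apply typ_rec_mono; try (intros; apply Hs; auto; fail);
      intros K X; destruct (pvsubst_psub_comp X f (pv_renaming_up Hg)) as (f' & g' & Hg' & E);
      rewrite !E; apply IH; auto; rewrite <- E; apply lc_at_pvopen; auto.
  - destruct Hl as (Hl1 & Hl2).
    split; apply typ_par_mono; intros; try (apply (IH1 f g Hg Hl1); auto; fail); apply (IH2 f g Hg Hl2); auto.
  - assert (Hs := sc_free_ids (sc_psub (id_up 1 f) Hg HPQ)).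
    split; apply typ_nu_mono; try (intros; apply Hs; auto; fail);
      intros K us Hus Hn; apply (Hopen P Q _ _ 1); auto.
  - assert (Hs := sc_free_ids (sc_psub (id_up 1 f) Hg HPQ)).
    split; apply typ_alloc_mono; try (intros; apply Hs; auto; fail);
      intros K us Hus Hn; apply (Hopen P Q _ _ 1); auto.
  - destruct Hl as (_ & Hl). split; apply typ_free_mono; intros; apply (IH f g Hg Hl); auto.
Qed.

Theorem sc_typ P Q G : sc P Q -> lc P -> typ G P <-> typ G Q.
Proof.
  intros HPQ Hl. rewrite <- (psub_id P), <- (psub_id Q).
  apply sc_typ_psub; auto using pv_renaming_PVar. rewrite psub_id; auto.
Qed.

(** * Refinements of a functional environment *)

Definition un_or_aff (Ts : list ty) (T : ty) : Prop := T = TCh Ts Un \/ T = TCh Ts Aff.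

(* [shares T L]: a single assumption of type [T] can be turned by structural
   rules into assumptions of types [L] on the same key. *)
Definition shares (T : ty) (L : list ty) : Prop :=
  match T with
  | TProc => Forall (eq TProc) L
  | TCh Ts Aff => L = [] \/ L = [TCh Ts Aff]
  | TCh Ts Un => Forall (un_or_aff Ts) L
  | TCh Ts (Uniq i) => exists Ts', (i = 0 \/ Ts' = Ts) /\
      (Forall (un_or_aff Ts') L \/
       exists n j, i + n <= j /\
         Permutation L (TCh Ts' (Uniq j) :: repeat (TCh Ts' Aff) n))
  end.

Lemma shares_refl T : shares T [T].
Proof.
  destruct T as [Ts [| |i]|]; simpl; auto.
  - constructor; auto; left; auto.
  - exists Ts; split; auto. right; exists 0, i; split; auto. lia.
Qed.

Lemma shares_perm T L L' : Permutation L L' -> shares T L -> shares T L'.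
Proof.
  intros Hp; destruct T as [Ts [| |i]|]; simpl.
  - intros [->| ->]; [apply Permutation_nil in Hp|apply Permutation_length_1_inv in Hp]; auto.
  - apply Permutation_Forall; auto.
  - intros (Ts' & HTs & [H|(n & j & Hj & H)]); exists Ts'; split; auto.
    + left; eapply Permutation_Forall; eauto.
    + right; exists n, j; split; auto. rewrite <- Hp; auto.
  - apply Permutation_Forall; auto.
Qed.

Lemma perm_uniq_inv T Ts j n L :
  Permutation (T :: L) (TCh Ts (Uniq j) :: repeat (TCh Ts Aff) n) ->
  (T = TCh Ts (Uniq j) /\ Permutation L (repeat (TCh Ts Aff) n)) \/
  (exists m, n = S m /\ T = TCh Ts Aff /\ Permutation L (TCh Ts (Uniq j) :: repeat (TCh Ts Aff) m)).
Proof.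
  intros Hp. assert (Hin : In T (TCh Ts (Uniq j) :: repeat (TCh Ts Aff) n))
    by (eapply Permutation_in; [exact Hp|simpl; auto]).
  destruct Hin as [<-|Hin].
  - left; split; auto. eapply Permutation_cons_inv; eauto.
  - right. destruct n as [|m]; [contradiction|]. apply repeat_spec in Hin; subst T.
    exists m; repeat split; auto. eapply Permutation_cons_inv.
    rewrite Hp. apply perm_swap.
Qed.

Lemma un_or_aff_repeat Ts n L :
  Permutation L (repeat (TCh Ts Aff) n) -> Forall (un_or_aff Ts) L.
Proof.
  intros Hp. eapply Permutation_Forall; [symmetry; exact Hp|].
  apply Forall_forall; intros T HT; apply repeat_spec in HT; right; auto.
Qed.

Lemma un_or_aff_step Ts T L L' :
  Forall (un_or_aff Ts) (T :: L) -> item_step T L' -> Forall (un_or_aff Ts) (L' ++ L).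
Proof.
  intros H Hs; inversion H as [|? ? HT HL]; subst.
  apply Forall_app; split; auto.
  destruct HT as [->| ->]; inversion Hs as [? ? ? Hsp|?|? ? Hsb|]; subst; auto;
    try (inversion Hsp; subst); try (inversion Hsb as [? ? ? Ha]; subst; inversion Ha; subst);
    repeat apply Forall_cons; auto; unfold un_or_aff; auto.
Qed.

Lemma shares_step T T' L L' : shares T (T' :: L) -> item_step T' L' -> shares T (L' ++ L).
Proof.
  destruct T as [Ts [| |i]|]; simpl; intros H Hs.
  - destruct H as [H|H]; inversion H; subst.
    inversion Hs as [? ? ? Hsp|?|? ? Hsb|]; subst; auto;
      [inversion Hsp|inversion Hsb as [? ? ? Ha]; inversion Ha].
  - eapply un_or_aff_step; eauto.
  - destruct H as (Ts' & HTs & [H|(n & j & Hj & H)]).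
    + exists Ts'; split; auto; left; eapply un_or_aff_step; eauto.
    + apply perm_uniq_inv in H as [[-> H]|(m & -> & -> & H)].
      * inversion Hs as [? ? ? Hsp|?|? ? Hsb|]; subst.
        -- inversion Hsp; subst. exists Ts'; split; auto. right; exists (S n), (S j); split; [lia|].
           simpl. rewrite H. apply perm_swap.
        (* Weakening away the unique assumption leaves only affine ones, covered by the first
           alternative. *)
        -- exists Ts'; split; auto. left; eapply un_or_aff_repeat; eauto.
        -- inversion Hsb as [? ? ? Ha]; subst. exists Ts'; split; auto. inversion Ha; subst.
           ++ right; exists n, (S j); split; [lia|]. simpl; auto.
           ++ left; simpl; constructor; [left; auto|eapply un_or_aff_repeat; eauto].
        (* Changing object types requires [j = 0], and [i + n <= j] then rules out any affine
           assumption still carrying the old ones. *)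
        -- assert (i = 0 /\ n = 0) as [-> ->] by lia. simpl in H.
           apply Permutation_sym, Permutation_nil in H; subst.
           exists Ts2; split; auto. right; exists 0, 0; split; auto.
      * inversion Hs as [? ? ? Hsp|?|? ? Hsb|]; subst; simpl;
          try (inversion Hsp; fail); try (inversion Hsb as [? ? ? Ha]; inversion Ha; fail).
        exists Ts'; split; auto. right; exists m, j; split; auto; lia.
  - inversion H as [|? ? HT HL]; subst. apply Forall_app; split; auto.
    inversion Hs as [? ? ? Hsp|?|? ? Hsb|]; subst; auto; [inversion Hsp; subst; auto|inversion Hsb].
Qed.

Lemma ref_one k T T' : item_step T [T'] -> ref [(k, T)] [(k, T')].
Proof. exact (@ref_step [] k T [T']). Qed.

Lemma ref_unr_shares k T L :
  unr_ty T -> (forall T', In T' L -> ref [(k, T)] [(k, T')]) -> ref [(k, T)] (map (pair k) L).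
Proof.
  intros HT; induction L as [|T' L IH]; simpl; intros HL; [apply ref_nil|].
  apply ref_trans with ([(k, T)] ++ [(k, T)]); [apply unr_dup; constructor; auto|].
  exact (ref_app (HL T' (or_introl Logic.eq_refl)) (IH (fun T H => HL T (or_intror H)))).
Qed.

Lemma ref_uniq_le k Ts i j : i <= j -> ref [(k, TCh Ts (Uniq i))] [(k, TCh Ts (Uniq j))].
Proof.
  intros Hij; replace j with ((j - i) + i) by lia. generalize (j - i) as d; clear.
  intros d; induction d as [|d IH]; [apply ref_refl|].
  eapply ref_trans; [exact IH|]. apply ref_one, step_sub. constructor. constructor.
Qed.

Lemma ref_un_shares k Ts L :
  Forall (un_or_aff Ts) L -> ref [(k, TCh Ts Un)] (map (pair k) L).
Proof.
  intros HL; apply ref_unr_shares; simpl; auto. rewrite Forall_forall in HL.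
  intros T HT; apply HL in HT as [->| ->]; [apply ref_refl|].
  apply ref_one, step_sub; constructor; constructor.
Qed.

Lemma shares_ref k T L : shares T L -> ref [(k, T)] (map (pair k) L).
Proof.
  destruct T as [Ts [| |i]|]; simpl.
  - intros [->| ->]; [apply ref_nil|apply ref_refl].
  - apply ref_un_shares.
  - intros (Ts' & HTs & HL). apply ref_trans with [(k, TCh Ts' (Uniq i))].
    { destruct HTs as [->| ->]; [apply ref_one, step_bullet0|apply ref_refl]. }
    destruct HL as [HL|(n & j & Hj & HL)].
    (* Subtyping to [Un] starts only from a successor index, so [i] is first raised by one. *)
    + eapply ref_trans; [apply (@ref_uniq_le _ _ i (S i)); lia|].
      eapply ref_trans; [|apply ref_un_shares; exact HL].
      apply ref_one, step_sub; constructor; constructor.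
    + eapply ref_trans; [|apply ref_perm, Permutation_map; symmetry; exact HL].
      (* Each affine assumption split off raises the index by one: [n] splits lead to [i + n], and
         subtyping goes on to [j]. *)
      clear HTs HL. revert i Hj; induction n as [|n IH]; intros i Hj.
      * apply ref_uniq_le; lia.
      * simpl.
        apply ref_trans with ([(k, TCh Ts' Aff)] ++ [(k, TCh Ts' (Uniq (S i)))]).
        { apply (@ref_step [] k _ [_; _]), step_split; constructor. }
        eapply ref_trans; [apply ref_app_l, IH; lia|].
        apply ref_perm; simpl. apply perm_swap.
  - intros HL; apply ref_unr_shares; simpl; auto. rewrite Forall_forall in HL.
    intros T HT; apply HL in HT as <-; apply ref_refl.
Qed.

Definition types_at (k : key) (G : env) : list ty := map snd (at_key k G).

Lemma types_at_app k G H : types_at k (G ++ H) = types_at k G ++ types_at k H.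
Proof. unfold types_at; rewrite at_key_app; apply map_app. Qed.

Lemma types_at_pair k L : types_at k (map (pair k) L) = L.
Proof.
  unfold types_at. induction L as [|T L IH]; simpl; auto.
  unfold keyb; destruct (key_eq_dec k k); [|contradiction]. simpl; f_equal; auto.
Qed.

Lemma types_at_cons k T G : types_at k ((k, T) :: G) = T :: types_at k G.
Proof.
  change ((k, T) :: G) with (map (pair k) [T] ++ G).
  rewrite types_at_app, types_at_pair; auto.
Qed.

Lemma types_at_notin k G : ~ In k (keys G) -> types_at k G = [].
Proof. intros H; unfold types_at; rewrite at_key_notin; auto. Qed.

Lemma types_at_other k l L : k <> l -> types_at k (map (pair l) L) = [].
Proof.
  intros Hkl; apply types_at_notin. unfold keys; rewrite map_map.
  intros H; apply in_map_iff in H as (T & E & _); simpl in E; congruence.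
Qed.

Lemma at_key_types k G : at_key k G = map (pair k) (types_at k G).
Proof.
  unfold types_at. induction G as [|[l T] G IH]; simpl; auto.
  unfold keyb; destruct (key_eq_dec l k); simpl; auto. subst; f_equal; auto.
Qed.

Lemma types_at_off_key k l G : k <> l -> types_at k (off_key l G) = types_at k G.
Proof.
  intros Hkl; unfold types_at. induction G as [|[m T] G IH]; simpl; auto.
  unfold keyb; destruct (key_eq_dec m l), (key_eq_dec m k); simpl; subst;
    try contradiction; auto; unfold keyb;
    (destruct (key_eq_dec _ _); [try congruence|try congruence]); simpl; auto. f_equal; auto.
Qed.

Lemma functional_types_at G k T : NoDup (keys G) -> In (k, T) G -> types_at k G = [T].
Proof.
  induction G as [|[l S] G IH]; simpl; [tauto|]. intros Hn. inversion Hn; subst.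
  intros [E|Hi].
  - inversion E; subst. rewrite types_at_cons, types_at_notin; auto.
  - unfold types_at; simpl. unfold keyb; destruct (key_eq_dec l k); simpl.
    + subst. exfalso; apply H1. apply (in_map fst _ _ Hi).
    + apply IH; auto.
Qed.

(** Reduces refinement to a separate condition on the list of types at each key, which decrement and
    deallocation can then check by plain list reasoning. *)
Lemma functional_ref G H : NoDup (keys G) ->
  ref G H <->
  (forall k, In k (keys H) -> In k (keys G)) /\
  (forall k T, In (k, T) G -> shares T (types_at k H)).
Proof.
  intros Hn; split.
  - intros HG; split; [intros k; apply ref_keys; auto|]. intros k T Hi.
    (* The intermediate environments are no longer functional; what passes through them is that [T]
       shares into the types found at [k]. *)
    assert (H0 : shares T (types_at k G)) by (rewrite (functional_types_at Hn Hi); apply shares_refl).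
    clear Hi Hn; revert H0; induction HG as [G G' Hp|G l T' L Hs|]; auto.
    + apply shares_perm, Permutation_map, filter_perm; auto.
    + rewrite !types_at_app. change [(l, T')] with (map (pair l) [T']).
      destruct (key_eq_dec k l) as [<-|Hkl].
      * rewrite !types_at_pair. intros H0.
        eapply shares_perm; [apply Permutation_app_comm|].
        eapply shares_step; eauto. eapply shares_perm; [|exact H0]. symmetry; apply Permutation_cons_append.
      * rewrite !types_at_other by auto. auto.
  - revert H; induction G as [|[k T] G IH]; intros H [Hk HG].
    + destruct H as [|[k T] H]; [apply ref_refl|]. exfalso; apply (Hk k); simpl; auto.
    + inversion Hn; subst.
      eapply ref_trans; [|apply ref_perm, Permutation_sym, (off_at_key_perm k)].
      change ((k, T) :: G) with ([(k, T)] ++ G).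
      eapply ref_trans; [apply ref_app_comm|]. apply ref_app.
      * apply IH; auto. split.
        -- intros l Hl; apply in_keys_off_key in Hl as [Hl Hlk].
           apply Hk in Hl as [<-|Hl]; auto. contradiction.
        -- intros l S Hi. rewrite types_at_off_key; [apply HG; simpl; auto|].
           intros ->; apply H2. apply (in_map fst _ _ Hi).
      * rewrite at_key_types; apply shares_ref, HG; simpl; auto.
Qed.

(** * Communication and deallocation on a shared channel *)

(** A total form of [decr]. The truncated predecessor at [Uniq 0] is a junk value, and [decr_Some]
    excludes that case. *)
Definition decr_tys (Ts : list ty) (a : attr) : list ty :=
  match a with Aff => [] | Un => [TCh Ts Un] | Uniq i => [TCh Ts (Uniq i.-1)] end.

Lemma decr_Some k Ts a D :
  decr k Ts a = Some D -> D = map (pair k) (decr_tys Ts a) /\ a <> Uniq 0.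
Proof. destruct a as [| |[|i]]; simpl; intros H; inversion H; split; auto; congruence. Qed.

(* Decrementing both endpoints of a communication gives back at least as much
   capability as was split off, so the assumption on the channel is unchanged. *)
Lemma shares_decr T Ts1 a1 Ts2 a2 L :
  shares T (TCh Ts1 a1 :: TCh Ts2 a2 :: L) -> a1 <> Uniq 0 -> a2 <> Uniq 0 ->
  Ts1 = Ts2 /\ shares T (decr_tys Ts1 a1 ++ decr_tys Ts2 a2 ++ L).
Proof.
  intros H Ha1 Ha2.
  assert (Hun : forall Ts, Forall (un_or_aff Ts) (TCh Ts1 a1 :: TCh Ts2 a2 :: L) ->
    Ts1 = Ts2 /\ Forall (un_or_aff Ts) (decr_tys Ts1 a1 ++ decr_tys Ts2 a2 ++ L)).
  { intros Ts HF. inversion HF as [|? ? HT1 HF']; inversion HF' as [|? ? HT2 HL]; subst.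
    destruct HT1 as [E1|E1], HT2 as [E2|E2]; inversion E1; inversion E2; subst; split; auto; simpl;
      repeat apply Forall_cons; auto; unfold un_or_aff; auto. }
  destruct T as [Ts [| |i]|]; simpl in H |- *.
  - destruct H as [H|H]; discriminate.
  - auto.
  - destruct H as (Ts' & HTs & [H|(n & j & Hj & H)]).
    + apply Hun in H as [E H]; split; auto. exists Ts'; auto.
    + apply perm_uniq_inv in H as [[E H]|(m & -> & E & H)]; inversion E; subst.
      * destruct n as [|n]; [apply Permutation_sym, Permutation_nil in H; discriminate|].
        assert (H2 := un_or_aff_repeat H). inversion H2 as [|? ? HT _]; subst.
        assert (Hin : In (TCh Ts2 a2) (repeat (TCh Ts' Aff) (S n)))
          by (eapply Permutation_in; [exact H|simpl; auto]).
        apply repeat_spec in Hin; inversion Hin; subst. split; auto.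
        (* One endpoint is unique and the other affine. The affine one is consumed and [j] drops by
           one, so [i + S n <= j] becomes [i + n <= j.-1]. *)
        exists Ts'; split; auto. right; exists n, j.-1; split;
          [|simpl; constructor; eapply Permutation_cons_inv; exact H].
        destruct j; [congruence|simpl; lia].
      * apply perm_uniq_inv in H as [[E2 H]|(m2 & -> & E2 & H)]; inversion E2; subst; split; auto;
          exists Ts'; split; auto; right.
        -- exists m, j.-1; split; [destruct j; [congruence|simpl; lia]|simpl; auto].
        -- exists m2, j; split; [lia|auto].
  - inversion H; discriminate.
Qed.

(** The index of a unique assumption bounds the number of affine ones beside it, so at index 0 there
    are none. *)
Lemma shares_uniq0 T Ts L : shares T (TCh Ts (Uniq 0) :: L) -> L = [].
Proof.
  assert (Hun : forall Ts', ~ Forall (un_or_aff Ts') (TCh Ts (Uniq 0) :: L)).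
  { intros Ts' HF; inversion HF as [|? ? [H1|H1] _]; discriminate. }
  destruct T as [Ts' [| |i]|]; simpl.
  - intros [H|H]; discriminate.
  - intros H; apply Hun in H; contradiction.
  - intros (Ts2 & _ & [H|(n & j & Hj & H)]); [apply Hun in H; contradiction|].
    apply perm_uniq_inv in H as [[E H]|(m & -> & E & H)]; inversion E; subst.
    assert (n = 0) as -> by lia. apply Permutation_sym, Permutation_nil in H; auto.
  - intros H; inversion H; discriminate.
Qed.

Lemma ref_keys_lookup G H k : ref G H -> In k (keys H) -> exists T, In (k, T) G.
Proof.
  intros HG Hk; apply (ref_keys HG) in Hk. apply in_map_iff in Hk as ([l T] & <- & Hi); eauto.
Qed.

Lemma functional_decr G k Ts1 a1 D1 Ts2 a2 D2 R :
  NoDup (keys G) -> ref G ((k, TCh Ts1 a1) :: (k, TCh Ts2 a2) :: R) ->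
  decr k Ts1 a1 = Some D1 -> decr k Ts2 a2 = Some D2 ->
  Ts1 = Ts2 /\ ref G (D1 ++ D2 ++ R).
Proof.
  intros Hn HG H1 H2. apply decr_Some in H1 as [-> Ha1], H2 as [-> Ha2].
  destruct (@ref_keys_lookup _ _ k HG) as [T HT]; [simpl; auto|].
  pose proof (proj1 (functional_ref _ Hn) HG) as [Hk Hs].
  assert (HD := Hs _ _ HT). rewrite !types_at_cons in HD.
  apply shares_decr in HD as [E HD]; auto. split; auto.
  apply (functional_ref _ Hn); split.
  - intros l; rewrite !keys_app, !in_app_iff. unfold keys at 1 2; rewrite !map_map.
    intros [Hl|[Hl|Hl]]; apply Hk; [| |simpl; auto];
      apply in_map_iff in Hl as (S & <- & _); simpl; auto.
  - intros l S Hi. destruct (key_eq_dec l k) as [->|Hlk].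
    + assert (S = T) as ->.
      { assert (ES := functional_types_at Hn Hi); rewrite (functional_types_at Hn HT) in ES; congruence. }
      rewrite !types_at_app, !types_at_pair; auto.
    + rewrite !types_at_app, !types_at_other by auto. apply Hs in Hi.
      change ((k, TCh Ts1 a1) :: (k, TCh Ts2 a2) :: R)
        with (map (pair k) [TCh Ts1 a1; TCh Ts2 a2] ++ R) in Hi.
      rewrite types_at_app, types_at_other in Hi; auto.
Qed.

Lemma functional_uniq0 G k Ts R :
  NoDup (keys G) -> ref G ((k, TCh Ts (Uniq 0)) :: R) -> ~ In k (keys R).
Proof.
  intros Hn HG Hi.
  destruct (@ref_keys_lookup _ _ k HG) as [T HT]; [simpl; auto|].
  pose proof (proj1 (functional_ref _ Hn) HG) as [_ Hs].
  apply Hs in HT. rewrite types_at_cons in HT. apply shares_uniq0 in HT.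
  apply in_map_iff in Hi as ([l S] & <- & Hi); simpl in HT.
  assert (Hin : In S (types_at l R)).
  { apply (in_map snd _ (l, S)). apply filter_In; split; auto.
    simpl; unfold keyb; destruct (key_eq_dec l l); auto. }
  rewrite HT in Hin; contradiction.
Qed.

(** * Subject reduction *)

Definition allocated (σ : state) (G : env) : Prop :=
  forall c, In (KId (Nm c)) (keys G) -> σ.[? c]%fmap = Some Top.

Lemma fnd_set_neq (σ : state) c d s : d <> c -> (σ.[c <- s]).[? d]%fmap = σ.[? d]%fmap.
Proof. move=> /eqP/negPf H; rewrite fnd_set, H; auto. Qed.

Lemma fnd_rem1_neq (σ : state) c d : d <> c -> (σ.[~ c]).[? d]%fmap = σ.[? d]%fmap.
Proof. move=> /eqP/negPf H; rewrite fnd_rem1, H; auto. Qed.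

Lemma fnd_rem1_eq (σ : state) c : (σ.[~ c]).[? c]%fmap = None.
Proof. rewrite fnd_rem1, eqxx; auto. Qed.

(* Preservation relative to the assumptions [F] used by the surrounding
   context: only [G] has to be functional, not its share [H]. *)
Definition preserves (σ : state) (P : proc) (σ' : state) (P' : proc) : Prop :=
  forall G H F, NoDup (keys G) -> allocated σ G -> ref G (H ++ F) -> typ H P ->
  exists G' H', NoDup (keys G') /\ allocated σ' G' /\ ref G' (H' ++ F) /\ typ H' P'.

Lemma preserves_typ σ P P' : (forall H, typ H P -> typ H P') -> preserves σ P σ P'.
Proof. intros HP G H F Hn Ha HG HT; exists G, H; auto. Qed.

Lemma NoDup_off_key k G : NoDup (keys G) -> NoDup (keys (off_key k G)).
Proof.
  induction G as [|[l T] G IH]; simpl; auto. intros Hn; inversion Hn; subst.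
  destruct (negb (keyb l k)); auto. simpl; constructor; auto.
  intros Hi; apply in_keys_off_key in Hi; tauto.
Qed.

Lemma preserves_com σ c bs n P Q :
  length bs = n ->
  preserves σ (PPar (POut (Nm c) (map Nm bs) Q) (PInp (Nm c) n P)) σ (PPar Q (open (map Nm bs) P)).
Proof.
  intros Hbs G H F Hn Ha HG HT. exists G.
  apply typ_par_inv in HT as (H1 & H2 & HH & HT1 & HT2).
  apply typ_inv in HT1 as (K1 & HK1 & G1 & Ts1 & a1 & D1 & -> & HD1 & Hl1 & HQ).
  apply typ_inv in HT2 as (K2 & HK2 & G2 & Ts2 & a2 & D2 & xs & -> & -> & HD2 & Hl2 & Hnx & Hfr & HP).
  set (B := combine (map KId (map Nm bs)) Ts1) in *.
  assert (HG' : ref G ((KId (Nm c), TCh Ts1 a1) :: (KId (Nm c), TCh Ts2 a2) :: G1 ++ G2 ++ B ++ F)).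
  { eapply ref_trans; [exact HG|].
    eapply ref_trans; [apply ref_app; [exact HH|apply ref_refl]|].
    eapply ref_trans; [apply ref_app; [apply ref_app; [exact HK1|exact HK2]|apply ref_refl]|].
    apply ref_perm. rewrite <- !app_assoc. simpl.
    symmetry; apply Permutation_cons_app. rewrite !app_assoc.
    apply Permutation_cons_app. rewrite <- !app_assoc. apply Permutation_app_head.
    rewrite !app_assoc. apply Permutation_app_tail, Permutation_app_comm. }
  destruct (functional_decr Hn HG' HD1 HD2) as [<- HG2].
  (* The payload assumptions [B] move from the sender's share to the receiver's. They match the
     parameters because the object types have just been identified. *)
  exists ((G1 ++ D1) ++ (G2 ++ D2 ++ B)); repeat split; auto.
  - eapply ref_trans; [exact HG2|]. apply ref_perm.
    rewrite <- !app_assoc, (Permutation_app_swap_app D2 G1), (Permutation_app_swap_app D1 G1).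
    rewrite (Permutation_app_swap_app D2 G2); auto.
  - apply typ_par; auto. rewrite app_assoc in HP |- *.
    apply (@typ_reopen _ (map FV xs) (map Nm bs)); auto using lc_FV, lc_Nm.
    + apply NoDup_map_NoDup_ForallPairs; auto; intros x y _ _ E; congruence.
    + rewrite !length_map; auto.
    + intros u Hu; apply in_map_iff in Hu as (x & <- & Hx). apply Hfr; auto.
    + intros u Hu; apply in_map_iff in Hu as (x & <- & Hx). rewrite keys_app, in_app_iff.
      intros [Hi|Hi]; [apply Hfr in Hx; tauto|].
      apply (proj1 (decr_KId HD2)) in Hi; congruence.
Qed.

(** The recursion is substituted for the derivation's [X], whose assumption turns into a second copy
    of [H]. The two copies come from one because [H] is unrestricted. *)
Lemma typ_rec_unfold G P : lc (PRec P) -> typ G (PRec P) -> typ G (pvsubst (PRec P) P).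
Proof.
  intros Hl HT; apply typ_inv in HT as (H & HG & X & Hu & HX1 & HX2 & HP).
  eapply typ_ref; [exact HG|].
  pose (g := fun Z => match Z with PFV Y => if Nat.eqb Y X then PRec P else PVar Z | _ => PVar Z end).
  pose (U := fun Y => if Nat.eqb Y X then H else pv_env Y).
  assert (HR : typ (env_sub (fun u => u) U (H ++ [(KPV X, TProc)]))
                   (psub (fun u => u) g (pvsubst (PVar (PFV X)) P))).
  { apply typ_psub; auto using id_renaming_id. intros Y. unfold g, U.
    destruct (Nat.eqb_spec Y X); [repeat split; auto; eapply typ_rec; eauto|].
    repeat split; [constructor; simpl; auto|apply typ_var]. }
  replace (psub _ _ _) with (pvsubst (PRec P) P) in HR.
  - eapply typ_ref; [|exact HR]. eapply ref_trans; [apply unr_dup; auto|].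
    rewrite env_sub_app. apply ref_app.
    + rewrite (@env_sub_ext _ (fun u => u) U pv_env); auto; [apply ref_env_sub_id|].
      intros Y HY; unfold U. destruct (Nat.eqb_spec Y X); auto. subst; contradiction.
    + simpl. unfold U. rewrite Nat.eqb_refl, app_nil_r. apply ref_refl.
  - rewrite !pvsubst_psub, psub_comp; auto.
    + apply psub_ext; auto. intros [[|i]|Y] HY; simpl; auto.
      * rewrite Nat.eqb_refl; auto.
      * destruct (Nat.eqb_spec Y X); auto. subst; contradiction.
    + intros [[|i]|Y]; simpl; eauto.
Qed.

Lemma typ_if_inv G u v P Q : typ G (PIf u v P Q) -> typ G P /\ typ G Q.
Proof.
  intros H; apply typ_inv in H as (K & HG & _ & _ & HP & HQ); split; eapply typ_ref; eauto.
Qed.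

Lemma fnames_pclose c P k : ~ In c (fnames (pclose k c P)).
Proof.
  assert (Hid : forall k u, ~ In c (id_names (id_close k c u))).
  { intros j [i|x|d]; simpl; auto. destruct (Nat.eqb_spec d c); simpl; intuition congruence. }
  revert k; induction P as [u vs P IH|u n P IH| |u v P IHP Q IHQ|P IH|X|P IHP Q IHQ|s P IH|P IH|u P IH];
    intros k; simpl; rewrite ?cat_app, ?in_app_iff; auto;
    try (assert (Hu := Hid k u)); try (assert (Hv := Hid k v));
    try (specialize (IHP k); specialize (IHQ k); tauto); try (specialize (IH k); tauto).
  - intros [H|[H|H]]; [tauto| |eapply IH; eauto].
    apply in_flat_map in H as (w & Hw & H). apply in_map_iff in Hw as (v & <- & _). eapply Hid; eauto.
  - specialize (IH (k + n)). tauto.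
Qed.

(** [pclose] does not lift, so a dangling index 0 of [P] is captured together with [c]. Hence [c]
    heads the list and [ds] serve the indices from 1 on. *)
Lemma open_popen_close c ds P :
  open [Nm c] (popen 1 (map Nm ds) (pclose 0 c P)) = open (map Nm (c :: ds)) P.
Proof.
  rewrite pclose_psub, popen_psub, !open_psub; auto using lc_Nm; [|repeat constructor].
  rewrite !psub_comp by eauto. apply psub_ext; auto.
  intros [[|i]|x|d] _; simpl; auto.
  - rewrite ?subn1; simpl.
    destruct (Nat.lt_ge_cases i (length (map Nm ds))) as [Hi|Hi].
    + rewrite (nth_indep _ (BV i) (BV (S i))) by auto.
      assert (Hin := nth_In _ (BV (S i)) Hi). apply in_map_iff in Hin as (e & <- & _). auto.
    + rewrite !nth_overflow by auto. simpl. destruct i; auto.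
  - destruct (Nat.eqb_spec d c); subst; auto.
Qed.

Lemma open_lc us P : Forall (id_lc 0) us -> lc P -> open us P = P.
Proof. intros Hus HP; rewrite open_psub by auto. apply psub_lc; [auto|split; auto|intros X; auto]. Qed.

Lemma popen_nil P k : popen k [] P = P.
Proof.
  rewrite popen_psub by constructor. rewrite <- (psub_id P) at 2. apply psub_ext; auto.
  intros u _; rewrite <- (id_up_id k u) at 2. apply id_up_ext; intros; destruct u; simpl;
    try destruct i; auto; match goal with |- context [nth ?i [] _] => destruct i end; auto.
Qed.

Lemma open_close c P : lc P -> open [Nm c] (close c P) = P.
Proof.
  intros HP. unfold close. rewrite <- (popen_nil (pclose 0 c P) 1).
  rewrite (@open_popen_close c []). apply open_lc; auto. apply lc_Nm.
Qed.

Lemma preserves_alloc σ c P :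
  lc (PAlloc P) -> (c \notin domf σ)%fset ->
  preserves σ (PAlloc P) σ (PNu Top (close c (open [Nm c] P))).
Proof.
  intros Hl Hc G H F Hn Ha HG HT. exists G, H; repeat split; auto.
  apply (typ_alloc_inv c) in HT as [Ts HT].
  apply typ_nu with c (TCh Ts (Uniq 0)).
  - apply fnames_pclose.
  (* Freshness for [H] comes from the state: every name in [H] is in [G], hence allocated, and [c]
     lies outside the domain. *)
  - intros Hi. assert (Hi' : In (KId (Nm c)) (keys G)).
    { eapply ref_keys; [exact HG|]. rewrite keys_app, in_app_iff; auto. }
    apply Ha in Hi'. rewrite not_fnd in Hi'; auto; discriminate.
  - rewrite open_close; auto. eapply lc_open; eauto; repeat constructor.
Qed.

Lemma preserves_free σ c P : preserves σ (PFree (Nm c) P) σ.[c <- Bot]%fmap P.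
Proof.
  intros G H F Hn Ha HG HT.
  apply typ_inv in HT as (K & HK & H0 & Ts & -> & HT).
  set (k := KId (Nm c)) in *.
  assert (HG' : ref G ((k, TCh Ts (Uniq 0)) :: H0 ++ F)).
  { eapply ref_trans; [exact HG|]. eapply ref_trans; [apply ref_app; [exact HK|apply ref_refl]|].
    apply ref_perm. rewrite <- app_assoc; simpl. symmetry; apply Permutation_middle. }
  assert (Hk := functional_uniq0 Hn HG').
  (* Neither the continuation nor the context keeps an assumption on [c], so it can leave [G] just
     as [c] ceases to be allocated. *)
  exists (off_key k G), H0; repeat split; auto using NoDup_off_key.
  - intros d Hd. apply in_keys_off_key in Hd as [Hd Hdc]. rewrite fnd_set_neq; [apply Ha; auto|].
    intros ->; apply Hdc; auto.
  - rewrite <- (off_key_notin Hk). apply ref_off_key.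
    eapply ref_trans; [exact HG'|]. exact (ref_drop_l [_] _).
Qed.

Lemma preserves_struct σ σ' P P1 Q1 Q :
  lc P -> lc Q -> sc P P1 -> sc Q1 Q -> preserves σ P1 σ' Q1 -> preserves σ P σ' Q.
Proof.
  intros HlP HlQ HP HQ Hpr G H F Hn Ha HG HT.
  apply (sc_typ H HP HlP) in HT.
  destruct (Hpr G H F Hn Ha HG HT) as (G' & H' & Hn' & Ha' & HG' & HT').
  exists G', H'; repeat split; auto. apply (sc_typ H' HQ); auto.
  apply (sc_lc_at HQ); auto.
Qed.

(* The processes in a context may contain dangling bound indices that the
   context's own binders capture, hence the instantiation by [ds]. *)
Lemma preserves_plug C σ P σ'' P'' :
  lc P -> lc P'' -> preserves σ P σ'' P'' ->
  forall ds σ1 P1 σ2 P2,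
  plug C σ P = Some (σ1, P1) -> plug C σ'' P'' = Some (σ2, P2) ->
  (forall d, In d ds -> σ1.[? d]%fmap <> None) ->
  preserves σ1 (open (map Nm ds) P1) σ2 (open (map Nm ds) P2).
Proof.
  intros Hl Hl'' Hpr.
  induction C as [|C IH Q|Q C IH|c C IH]; simpl; intros ds σ1 P1 σ2 P2 E1 E2 Hds.
  - inversion E1; inversion E2; subst. rewrite !open_lc; auto using lc_Nm.
  - destruct (plug C σ P) as [[σa Pa]|] eqn:Ea; [|discriminate].
    destruct (plug C σ'' P'') as [[σb Pb]|] eqn:Eb; [|discriminate].
    inversion E1; inversion E2; subst.
    specialize (IH ds _ _ _ _ Logic.eq_refl Logic.eq_refl Hds).
    intros G H F Hn Ha HG HT. apply typ_par_inv in HT as (H1 & H2 & HH & HT1 & HT2).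
    destruct (IH G H1 (H2 ++ F) Hn Ha) as (G' & H' & Hn' & Ha' & HG' & HT'); auto.
    { rewrite app_assoc. eapply ref_trans; [exact HG|]. apply ref_app; auto using ref_refl. }
    exists G', (H' ++ H2); repeat split; auto; [rewrite <- app_assoc; auto|].
    apply typ_par; auto.
  - destruct (plug C σ P) as [[σa Pa]|] eqn:Ea; [|discriminate].
    destruct (plug C σ'' P'') as [[σb Pb]|] eqn:Eb; [|discriminate].
    inversion E1; inversion E2; subst.
    specialize (IH ds _ _ _ _ Logic.eq_refl Logic.eq_refl Hds).
    intros G H F Hn Ha HG HT. apply typ_par_inv in HT as (H1 & H2 & HH & HT1 & HT2).
    destruct (IH G H2 (H1 ++ F) Hn Ha) as (G' & H' & Hn' & Ha' & HG' & HT'); auto.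
    { rewrite app_assoc. eapply ref_trans; [exact HG|]. apply ref_app; auto using ref_refl.
      eapply ref_trans; [exact HH|apply ref_app_comm]. }
    exists G', (H1 ++ H'); repeat split; auto.
    + eapply ref_trans; [exact HG'|]. rewrite <- app_assoc. apply ref_perm, Permutation_app_swap_app.
    + apply typ_par; auto.
  - destruct (plug C σ P) as [[σa Pa]|] eqn:Ea; [|discriminate].
    destruct (plug C σ'' P'') as [[σb Pb]|] eqn:Eb; [|discriminate].
    destruct (σa.[? c]%fmap) as [sa|] eqn:Esa; [|discriminate].
    destruct (σb.[? c]%fmap) as [sb|] eqn:Esb; [|discriminate].
    inversion E1; inversion E2; subst. clear E1 E2.
    (* The names in [ds] belong to outer binders and are still in the state, from which [plug] has
       just removed [c]. *)
    assert (Hcds : ~ In c ds).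
    { intros Hi; apply Hds in Hi. apply Hi, fnd_rem1_eq. }
    assert (Hfresh : forall R, ~ In c (fnames (popen 1 (map Nm ds) (pclose 0 c R)))).
    { intros R Hi; apply fnames_popen in Hi as [Hi|Hi]; [eapply fnames_pclose; eauto|].
      apply in_map_iff in Hi as (d & E & Hd); congruence. }
    specialize (IH (c :: ds) _ _ _ _ Logic.eq_refl Logic.eq_refl).
    intros G H F Hn Ha HG HT.
    change (open (map Nm ds) (PNu sa (close c Pa))) with (PNu sa (popen 1 (map Nm ds) (pclose 0 c Pa))) in HT.
    apply (typ_nu_inv c) in HT as [T HT]. rewrite open_popen_close in HT.
    set (k := KId (Nm c)) in *.
    assert (HkG : ~ In k (keys G)).
    { intros Hi; apply Ha in Hi. rewrite fnd_rem1_eq in Hi; discriminate. }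
    assert (HkF : ~ In k (keys F)).
    { intros Hi; apply HkG. eapply ref_keys; [exact HG|]. rewrite keys_app, in_app_iff; auto. }
    destruct (fun Hds' => IH Hds' (G ++ nu_env sa c T) (H ++ nu_env sa c T) F)
      as (G2 & H2 & Hn2 & Ha2 & HG2 & HT2); auto.
    + intros d [<-|Hd]; [congruence|]. assert (Hdc : d <> c) by (intros ->; contradiction).
      apply Hds in Hd. rewrite fnd_rem1_neq in Hd; auto.
    + destruct sa; simpl; [|rewrite app_nil_r; auto].
      rewrite keys_app. simpl. eapply Permutation_NoDup; [apply Permutation_cons_append|constructor; auto].
    + intros d Hd. rewrite keys_app, in_app_iff in Hd. destruct Hd as [Hd|Hd].
      * assert (Hdc : d <> c) by (intros ->; contradiction).
        apply Ha in Hd. rewrite fnd_rem1_neq in Hd; auto.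
      * destruct sa; simpl in Hd; [|tauto]. destruct Hd as [Hd|[]]. inversion Hd; subst; auto.
    + eapply ref_trans; [apply ref_app; [exact HG|apply ref_refl]|].
      rewrite <- !app_assoc. apply ref_app_l, ref_app_comm.
    + exists (off_key k G2), (off_key k H2); repeat split.
      * apply NoDup_off_key; auto.
      * intros d Hd; apply in_keys_off_key in Hd as [Hd Hdc]. rewrite fnd_rem1_neq; [apply Ha2; auto|].
        intros ->; apply Hdc; auto.
      * rewrite <- (off_key_notin HkF), <- off_key_app. apply ref_off_key; auto.
      * change (open (map Nm ds) (PNu sb (close c Pb))) with (PNu sb (popen 1 (map Nm ds) (pclose 0 c Pb))).
        (* The body's step may have changed or dropped the assumption on [c]. If it is still in
           [G2], then [c] is allocated and its type there serves as [T']. Otherwise [H2] has nothing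
           on [c], and any type will do for either state [sb]. *)
        assert (HT3 : exists T', ref (nu_env sb c T') (at_key k H2)).
        { assert (Hat := ref_at_key k HG2). rewrite at_key_app, (at_key_notin HkF), app_nil_r in Hat.
          destruct (in_dec key_eq_dec k (keys G2)) as [Hi|Hi].
          - assert (sb = Top) as -> by (apply Ha2 in Hi; congruence).
            apply in_map_iff in Hi as ([l T'] & El & Hi); simpl in El; subst l. exists T'.
            rewrite (at_key_types k G2), (functional_types_at Hn2 Hi) in Hat. exact Hat.
          - exists T. rewrite (at_key_notin Hi) in Hat. eapply ref_trans; [apply ref_nil|exact Hat]. }
        destruct HT3 as [T' HT3].
        apply typ_nu with c T'; auto; [rewrite in_keys_off_key; tauto|].
        rewrite open_popen_close. eapply typ_ref; [|exact HT2].
        eapply ref_trans; [|apply ref_perm, Permutation_sym, (off_at_key_perm k)].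
        apply ref_app_l; auto.
Qed.

Lemma red_closed σ P σ' P' : red σ P σ' P' -> closed_config σ P /\ closed_config σ' P'.
Proof. induction 1; auto. Qed.

Theorem red_preserves σ P σ' P' : red σ P σ' P' -> preserves σ P σ' P'.
Proof.
  induction 1 as [σ c bs n P Q _ _ Hbs _|σ P [[Hl _] _] _|σ c P Q _ _|σ c d P Q _ _ _
    |σ c P [[Hl _] _] _ Hc|σ c P _ _ _|C σ P σ'' P'' σ1 P1 σ2 P2 _ _ Hred IH E1 E2
    |σ σ' P P1 Q1 Q [[HlP _] _] [[HlQ _] _] HP Hred IH HQ].
  - apply preserves_com; auto.
  - apply preserves_typ; intros H; apply typ_rec_unfold; auto.
  - apply preserves_typ; intros H HT; apply typ_if_inv in HT; tauto.
  - apply preserves_typ; intros H HT; apply typ_if_inv in HT; tauto.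
  - apply preserves_alloc; auto.
  - apply preserves_free.
  - destruct (red_closed Hred) as [[[Hl _] _] [[Hl'' _] _]].
    assert (Hpl := @preserves_plug C σ P σ'' P'' Hl Hl'' IH [] σ1 P1 σ2 P2 E1 E2).
    unfold open in Hpl; simpl in Hpl. rewrite !popen_nil in Hpl. apply Hpl; intros d [].
  - eapply preserves_struct; eauto.
Qed.

Theorem mainTheorem3 (G : env) (σ σ' : state) (P P' : proc) :
  conf_typ G σ P -> red σ P σ' P' ->
  exists G' : env, conf_typ G' σ' P'.
Proof.
  intros (Ha & HT & Hn) Hred.
  destruct (@red_preserves _ _ _ _ Hred G G [] Hn Ha) as (G' & H' & Hn' & Ha' & HG' & HT'); auto.
  - rewrite app_nil_r; apply ref_refl.
  - rewrite app_nil_r in HG'. exists G'; repeat split; auto. eapply typ_ref; eauto.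
Qed.
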